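(* Let $(M_1,\omega_1,\Phi_1)$ and $(M_2,\omega_2,\Phi_2)$ be faithful semitoric systems satisfying (F7) that are strictly isomorphic as complexity one systems, and suppose that $(M_1,\omega_1,\Phi_1)$ has at least one focus-focus point. Then the sets of semitoric cartographic images of $(M_1,\omega_1,\Phi_1)$ and of $(M_2,\omega_2,\Phi_2)$ (both sets of subsets of $\mathbb{R}^2$) are equal.
   Context: Conventions. $S^1=\mathbb{R}/2\pi\mathbb{Z}$, $\mathbb{T}^2=(S^1)^2$. Subsets carry the subspace topology. A map on a subset of $\mathbb{R}^n$ is smooth if locally it extends to a smooth map on an open subset of $\mathbb{R}^n$; a smooth embedding of a subset is a diffeomorphism onto its image. A map $f:X\to Y$ is proper onto its image if $f:X\to f(X)$ is proper. Hamiltonian vector fields: $\omega(X_F,\cdot)=dF$; $\{F,G\}=\omega(X_F,X_G)$. Integrable systems. An integrable system (with two degrees of freedom) is a triple $(M,\omega,\Phi=(J,H))$ with $(M,\omega)$ a 4-dimensional symplectic manifold and $\Phi:M\to\mathbb{R}^2$ smooth with $\{J,H\}=0$ and $\Phi$ a submersion on an open dense subset of $M$. Fibers are assumed compact, so $\Phi$ generates a Hamiltonian $\mathbb{R}^2$-action; ''orbit'' means orbit of this action. Almost-toric orbits. A point $p$ is singular if $\operatorname{rk}D_p\Phi<2$; the rank $k$ of an orbit is $\operatorname{rk}D_p\Phi$ at any of its points. For a singular orbit $\mathcal{O}\ni p$, the linearized $\mathbb{R}^2$-action at $p$ on $(T_p\mathcal{O})^{\omega}/T_p\mathcal{O}\cong\mathbb{R}^{2(2-k)}$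 induces a Lie algebra homomorphism $\mathbb{R}^2\to\mathfrak{sp}(2(2-k);\mathbb{R})$ with image $\mathfrak{h}_{\mathcal{O}}$; $\mathcal{O}$ is non-degenerate if $\mathfrak{h}_{\mathcal{O}}$ is a Cartan subalgebra. Identify $\mathfrak{sp}(2m;\mathbb{R})$ with quadratic forms on $\mathbb{R}^{2m}$. A singular orbit is almost-toric if it is compact, non-degenerate and, in suitable linear symplectic coordinates, $\mathfrak{h}_{\mathcal{O}}$ is spanned by: $\frac{x_1^2+y_1^2}{2},\frac{x_2^2+y_2^2}{2}$ (rank 0, elliptic-elliptic); or $x_1y_2-x_2y_1,\ x_1y_1+x_2y_2$ (rank 0, focus-focus); or $\frac{x^2+y^2}{2}$ (rank 1, elliptic-regular). Faithful semitoric system. An integrable system $(M,\omega,\Phi=(J,H))$ on a connected 4-dimensional symplectic manifold such that: (F1) $\Phi$ is proper onto its image; (F2) all singular orbits are almost-toric; (F3) $J$ is the moment map of an effective Hamiltonian $S^1$-action; (F4) every fiber of $J$ is connected; (F5) the set of critical values of $J$ has no limit points in $J(M)$; (F6) every fiber of $J$ contains at most finitely many isolated fixed points of the $S^1$-action. Fibers of $\Phi$ are then connected. Put $B=\Phi(M)$. Focus-focus values are the images of focus-focus points; they form a countable discrete set $B_{\mathrm{ff}}=\{c_i=(x_i,y_i)\}_{i\in I}\subset\operatorname{Int}(B)$. (F7): every fiber of $\Phi$ contains at most one focus-focus point. Strict isomorphism. $(M_1,\omega_1,\Phi_1)$, $(M_2,\omega_2,\Phi_2)$ are strictly isomorphic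 as complexity one systems if there are a symplectomorphism $\Psi:(M_1,\omega_1)\to(M_2,\omega_2)$ and a diffeomorphism $\psi:\Phi_1(M_1)\to\Phi_2(M_2)$ of the form $\psi(x,y)=(x,\psi^{(2)}(x,y))$ with $\Phi_2\circ\Psi=\psi\circ\Phi_1$. $\mathbb{Z}$-affine structure. Put $B_{\mathrm{wt}}=B\smallsetminus B_{\mathrm{ff}}$. Each point of $B_{\mathrm{wt}}$ has an open neighborhood $U\subset B_{\mathrm{wt}}$ with a diffeomorphism $\psi:U\to\psi(U)\subset\mathbb{R}^2$ such that $\psi\circ\Phi|_{\Phi^{-1}(U)}$ is the moment map of an effective Hamiltonian $\mathbb{T}^2$-action; such $(U,\psi)$ are the charts of a $\mathbb{Z}$-affine structure on $B_{\mathrm{wt}}$ (transition maps are locally restrictions of elements of $\mathrm{AGL}(2;\mathbb{Z})=\mathrm{GL}(2;\mathbb{Z})\ltimes\mathbb{R}^2$). A cartographic pair $(f,S)$ consists of a topological embedding $f:B\to\mathbb{R}^2$ and $S\subset B_{\mathrm{wt}}$ open and dense in $B$, such that $f|_S$ is a smooth embedding that is $\mathbb{Z}$-affine, i.e. for each chart $\psi$, $f\circ\psi^{-1}$ is locally (on $\psi(U\cap S)$) the restriction of an element of $\mathrm{AGL}(2;\mathbb{Z})$. Semitoric cartographic pairs. For $\boldsymbol{\epsilon}=(\epsilon_i)\in\{+1,-1\}^I$ set $l^{\epsilon_i}=\{(x,y)\mid x=x_i,\ \epsilon_iy\ge\epsilon_iy_i\}\cap B$, $l^{\boldsymbol{\epsilon}}=\bigcup_il^{\epsilon_i}$,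 $S_{\boldsymbol{\epsilon}}=B\smallsetminus l^{\boldsymbol{\epsilon}}$, and $j_{\boldsymbol{\epsilon}}(x,y)=\sum_{\{i\mid(x,y)\in l^{\epsilon_i}\}}\epsilon_i$ for $(x,y)\in B_{\mathrm{wt}}$. A semitoric cartographic pair is a cartographic pair of the form $(f_{\boldsymbol{\epsilon}},S_{\boldsymbol{\epsilon}})$ for some $\boldsymbol{\epsilon}$, with $f_{\boldsymbol{\epsilon}}(x,y)=(x,f^{(2)}_{\boldsymbol{\epsilon}}(x,y))$, such that (C1) $\operatorname{sgn}(f_{\boldsymbol{\epsilon}}):=\operatorname{sgn}\big(\frac{\partial f^{(2)}_{\boldsymbol{\epsilon}}}{\partial y}\big)$ is constant on $S_{\boldsymbol{\epsilon}}$, and (C2) for all $(\mathsf{x},\mathsf{y})\in B_{\mathrm{wt}}$ (with points of $B$ on both sides), $\lim_{(x,y)\to(\mathsf{x},\mathsf{y}),\,x<\mathsf{x}}Df_{\boldsymbol{\epsilon}}(x,y)=\begin{pmatrix}1&0\\ \operatorname{sgn}(f_{\boldsymbol{\epsilon}})j_{\boldsymbol{\epsilon}}(\mathsf{x},\mathsf{y})&1\end{pmatrix}\lim_{(x,y)\to(\mathsf{x},\mathsf{y}),\,x>\mathsf{x}}Df_{\boldsymbol{\epsilon}}(x,y)$. The corresponding semitoric cartographic image is $f_{\boldsymbol{\epsilon}}(B)\subset\mathbb{R}^2$; the set of semitoric cartographic images ranges over all semitoric cartographic pairs (all $\boldsymbol{\epsilon}$). *)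

(* Defs.v *)
From HB Require Import structures.
From mathcomp Require Import all_boot all_order all_algebra.
From mathcomp Require Import all_classical all_reals all_analysis.

Set Implicit Arguments.
Unset Strict Implicit.
Unset Printing Implicit Defensive.

Import Order.TTheory GRing.Theory Num.Theory.
Import numFieldNormedType.Exports.

Local Open Scope classical_set_scope.
Local Open Scope ring_scope.

(* Conventions.  Vectors are rows.  [jacobian f x] is the matrix of the
   differential acting on rows, [v |-> v *m jacobian f x], i.e. the transpose
   of the usual Jacobian matrix.  A bilinear form with matrix W is
   [(u, v) |-> u *m W *m v^T]. *)

(** ** Smooth maps between (subsets of) vector spaces *)

Section Smooth.
Context {R : realType} {V W : normedModType R}.

Fixpoint Ck (k : nat) (U : set V) (f : V -> W) : Prop :=
  match k with
  | 0 => forall x, U x -> {for x, continuous f}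
  | k'.+1 => (forall x, U x -> differentiable f x) /\
             (forall v, Ck k' U ('D_v f))
  end.

(* meant for open [U] *)
Definition smooth_open (U : set V) (f : V -> W) : Prop := forall k, Ck k U f.

Definition extends_near (A : set V) (f : V -> W) (x : V)
    (U : set V) (g : V -> W) : Prop :=
  [/\ open U, U x, smooth_open U g & forall z, (U `&` A) z -> g z = f z].

Definition smooth_on (A : set V) (f : V -> W) : Prop :=
  forall x, A x -> exists U g, extends_near A f x U g.

End Smooth.

Section Embeddings.
Context {R : realType} {n : nat}.
Local Notation E := 'rV[R]_n.

Definition smooth_embedding (A : set E) (f : E -> E) : Prop :=
  smooth_on A f /\
  exists g, smooth_on (f @` A) g /\ forall x, A x -> g (f x) = x.

Definition topological_embedding (A : set E) (f : E -> E) : Prop :=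
  {within A, continuous f} /\
  exists g : E -> E, {within f @` A, continuous g} /\
    forall x, A x -> g (f x) = x.

(* The derivative, as the usual Jacobian matrix [d f_i / d x_j], of a map that
   is smooth on a subset [A], computed with any local smooth extension.  It is
   unambiguous when [A] lies in the closure of its interior, by continuity of
   the derivative of an extension. *)
Definition Dsub (A : set E) (f : E -> E) (x : E) : 'M[R]_n :=
  xget 0 [set L | exists U g, extends_near A f x U g /\ L = (jacobian g x)^T].

End Embeddings.

(** ** Symplectic 4-manifolds *)

(* The tangent space at [p] is identified with R^4 through the chart of index
   [chart_at p]. *)
Record manifold4 (R : realType) := Manifold4 {
  carrier :> topologicalType;
  idx : Type;
  dom : idx -> set carrier;
  chart : idx -> carrier -> 'rV[R]_4;
  param : idx -> 'rV[R]_4 -> carrier;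
  chart_at : carrier -> idx;
  mfd_hausdorff : hausdorff_space carrier;
  mfd_second_countable : @second_countable carrier;
  dom_open : forall i, open (dom i);
  image_open : forall i, open (chart i @` dom i);
  chart_continuous : forall i p, dom i p -> {for p, continuous (chart i)};
  param_continuous : forall i x, (chart i @` dom i) x ->
    {for x, continuous (param i)};
  chartK : forall i p, dom i p -> param i (chart i p) = p;
  dom_chart_at : forall p, dom (chart_at p) p;
  transition_smooth : forall i j,
    smooth_open (chart i @` (dom i `&` dom j)) (chart j \o param i)
}.

Section ManifoldMaps.
Context {R : realType}.

Definition smooth_to {V : normedModType R} (M : manifold4 R)
    (W : set M) (F : M -> V) : Prop :=
  forall i : idx M, smooth_open (chart i @` (dom i `&` W)) (F \o param i).

Definition smooth_map (M N : manifold4 R) (Psi : M -> N) : Prop :=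
  continuous Psi /\
  forall (i : idx M) (j : idx N),
    smooth_open (chart i @` (dom i `&` Psi @^-1` dom j))
                (chart j \o Psi \o param i).

Definition diffeomorphism (M N : manifold4 R) (Psi : M -> N) : Prop :=
  smooth_map Psi /\
  exists Psi' : N -> M, [/\ smooth_map Psi', cancel Psi Psi' & cancel Psi' Psi].

End ManifoldMaps.

(* [om i x] is the matrix of the symplectic form at the point [param i x] in
   the coordinates of the chart [i]. *)
Record symplectic4 (R : realType) := Symplectic4 {
  smfd :> manifold4 R;
  om : idx smfd -> 'rV[R]_4 -> 'M[R]_4;
  om_smooth : forall i a b,
    smooth_open (chart i @` dom i) (fun x => om i x a b);
  om_alternating : forall i x, (chart i @` dom i) x -> (om i x)^T = - om i x;
  om_nondegenerate : forall i x, (chart i @` dom i) x -> om i x \in unitmx;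
  om_closed : forall i x, (chart i @` dom i) x -> forall a b c : 'I_4,
    'D_(delta_mx 0 a) (fun y => om i y b c) x
    + 'D_(delta_mx 0 b) (fun y => om i y c a) x
    + 'D_(delta_mx 0 c) (fun y => om i y a b) x = 0;
  om_tensor : forall i j p, dom i p -> dom j p ->
    let T := jacobian (chart j \o param i) (chart i p) in
    om i (chart i p) = T *m om j (chart j p) *m T^T
}.

Section Hamiltonian.
Context {R : realType} {M : symplectic4 R}.

Definition grad (f : 'rV[R]_4 -> R) (x : 'rV[R]_4) : 'rV[R]_4 :=
  \row_a 'D_(delta_mx 0 a) f x.

(* The Hamiltonian vector field in the chart [i]: the solution X of
   X *m om i x *m v^T = dF(v) for all v. *)
Definition hamvec (F : M -> R) (i : idx M) (x : 'rV[R]_4) : 'rV[R]_4 :=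
  grad (F \o param i) x *m invmx (om i x).

Definition hamvec_at (F : M -> R) (p : M) : 'rV[R]_4 :=
  hamvec F (chart_at p) (chart (chart_at p) p).

Definition om_at (p : M) : 'M[R]_4 := om (chart_at p) (chart (chart_at p) p).

Definition poisson (F G : M -> R) (p : M) : R :=
  (hamvec_at F p *m om_at p *m (hamvec_at G p)^T) 0 0.

Definition integral_curve (F : M -> R) (gamma : R -> M) : Prop :=
  continuous gamma /\
  forall t i, dom i (gamma t) ->
    is_derive (t : R^o) (1 : R^o) (fun s : R^o => chart i (gamma s))
      (hamvec F i (chart i (gamma t))).

Definition pairing k (a : 'rV[R]_k) (mu : M -> 'rV[R]_k) : M -> R :=
  fun p => \sum_(l < k) a 0 l * mu p 0 l.

(* t is in the lattice (2 pi Z)^k, the kernel of R^k -> T^k *)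
Definition period_lattice k (t : 'rV[R]_k) : Prop :=
  exists m : 'rV[int]_k, t = (2 * pi) *: map_mx intr m.

(* [rho] is a smooth action of T^k = R^k / (2 pi Z)^k on the open subset [W];
   values of [rho] outside [W] are irrelevant. *)
Definition torus_action k (W : set M) (rho : 'rV[R]_k -> M -> M) : Prop :=
  [/\ forall t p, W p -> W (rho t p),
      forall p, W p -> rho 0 p = p,
      forall s t p, W p -> rho (s + t) p = rho s (rho t p),
      forall t p, W p -> period_lattice t -> rho t p = p &
      (forall t p, W p ->
         {for (t, p), continuous (fun u : 'rV[R]_k * M => rho u.1 u.2)}) /\
      forall i j : idx M,
        smooth_open
          [set u : 'rV[R]_k * 'rV[R]_4 | (chart i @` (dom i `&` W)) u.2 /\
                                         dom j (rho u.1 (param i u.2))]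
          (fun u => chart j (rho u.1 (param i u.2)))].

Definition effective k (W : set M) (rho : 'rV[R]_k -> M -> M) : Prop :=
  forall t, (forall p, W p -> rho t p = p) -> period_lattice t.

Definition moment_map k (W : set M) (rho : 'rV[R]_k -> M -> M)
    (mu : M -> 'rV[R]_k) : Prop :=
  smooth_to W mu /\
  forall a p, W p -> integral_curve (pairing a mu) (fun t => rho (t *: a) p).

End Hamiltonian.

(** ** Integrable systems and their singular orbits *)

Section Systems.
Context {R : realType} {M : symplectic4 R}.
Variable Phi : M -> 'rV[R]_2.

Definition fstJ : M -> R := fun p => Phi p 0 0.
Definition sndH : M -> R := fun p => Phi p 0 1.

Definition rk (p : M) : nat :=
  \rank (jacobian (Phi \o param (chart_at p)) (chart (chart_at p) p)).

Definition singular (p : M) : Prop := (rk p < 2)%N.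

Definition integrable_system : Prop :=
  [/\ smooth_to setT Phi,
      forall p, poisson fstJ sndH p = 0,
      exists D : set M, [/\ open D, dense D & forall p, D p -> rk p = 2%N] &
      forall c, compact (Phi @^-1` [set c])].

(* The R^2-action generated by Phi sends (a, p) to the time-one flow of p
   along the Hamiltonian vector field of a_1 J + a_2 H. *)
Definition orbit (p : M) : set M :=
  [set q | exists (a : 'rV[R]_2) (gamma : R -> M),
     [/\ integral_curve (pairing a Phi) gamma, gamma 0 = p & gamma 1 = q]].

(* Its row space is the tangent space of the orbit at [p]. *)
Definition orbit_tangent (p : M) : 'M[R]_(1 + 1, 4) :=
  col_mx (hamvec_at fstJ p) (hamvec_at sndH p).

(* The linearization at [p] of the Hamiltonian vector field of
   a_1 J + a_2 H, for [a] in the Lie algebra of the stabilizer of [p]. *)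
Definition stabilizer_algebra (p : M) (a : 'rV[R]_2) : Prop :=
  hamvec_at (pairing a Phi) p = 0.

Definition linearization (p : M) (a : 'rV[R]_2) : 'M[R]_4 :=
  jacobian (hamvec (pairing a Phi) (chart_at p)) (chart (chart_at p) p).

(* The standard symplectic form on R^(2m), coordinates (x_1..x_m, y_1..y_m) *)
Definition std_om m : 'M[R]_(m + m) := block_mx 0 1%:M (- 1%:M) 0.

Definition sp m : set 'M[R]_(m + m) :=
  [set B | B *m std_om m + std_om m *m B^T = 0].
Arguments sp : clear implicits.

(* The rows of [e] are vectors of (T_p O)^omega inducing a symplectic basis of
   (T_p O)^omega / T_p O.  By dimension count they automatically span it. *)
Definition symplectic_frame (p : M) m (e : 'M[R]_(m + m, 4)) : Prop :=
  [/\ (rk p + m)%N = 2%N,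
      e *m om_at p *m (orbit_tangent p)^T = 0 &
      e *m om_at p *m e^T = std_om m].

(* The subalgebra h_O, in the coordinates on (T_p O)^omega / T_p O given by
   the frame [e] *)
Definition slice_algebra (p : M) m (e : 'M[R]_(m + m, 4)) :
    set 'M[R]_(m + m) :=
  [set B | exists a, stabilizer_algebra p a /\
     (e *m linearization p a - B *m e <= orbit_tangent p)%MS].

Definition bracket n (A B : 'M[R]_n) : 'M[R]_n := A *m B - B *m A.

Fixpoint iterated_brackets n (h : set 'M[R]_n) (k : nat) : set 'M[R]_n :=
  match k with
  | 0 => h
  | k'.+1 => [set bracket A B | A in h & B in iterated_brackets h k']
  end.

Definition lie_subalgebra n (g h : set 'M[R]_n) : Prop :=
  [/\ h `<=` g, h 0,
      forall (s : R) A B, h A -> h B -> h (s *: A + B) &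
      forall A B, h A -> h B -> h (bracket A B)].

(* nilpotent and self-normalizing *)
Definition cartan_subalgebra n (g h : set 'M[R]_n) : Prop :=
  [/\ lie_subalgebra g h,
      exists k, iterated_brackets h k `<=` [set 0] &
      forall A, g A -> (forall B, h B -> h (bracket A B)) -> h A].

Definition non_degenerate (p : M) : Prop :=
  exists m (e : 'M[R]_(m + m, 4)),
    symplectic_frame p e /\ cartan_subalgebra (sp m) (slice_algebra p e).

(* The identification of quadratic forms with elements of sp(2m): [B] is the
   linear Hamiltonian vector field of [q], the polarization of [q] being
   (v, w) |-> dq_v(w). *)
Definition hamiltonian_matrix m (q : 'rV[R]_(m + m) -> R)
    (B : 'M[R]_(m + m)) : Prop :=
  forall v w, (v *m B *m std_om m *m w^T) 0 0 = q (v + w) - q v - q w.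

Definition quadratic_span m k (q : k.-tuple ('rV[R]_(m + m) -> R)) :
    set 'M[R]_(m + m) :=
  [set B | exists c : 'rV[R]_k,
     hamiltonian_matrix (fun v => \sum_(l < k) c 0 l * tnth q l v) B].

Definition xco m (i : 'I_m) (v : 'rV[R]_(m + m)) : R := v 0 (lshift m i).
Definition yco m (i : 'I_m) (v : 'rV[R]_(m + m)) : R := v 0 (rshift m i).

Definition ell_ell : 2.-tuple ('rV[R]_(2 + 2) -> R) :=
  [tuple (fun v => (xco 0 v ^+ 2 + yco 0 v ^+ 2) / 2);
         (fun v => (xco 1 v ^+ 2 + yco 1 v ^+ 2) / 2)].

Definition foc_foc : 2.-tuple ('rV[R]_(2 + 2) -> R) :=
  [tuple (fun v => xco 0 v * yco 1 v - xco 1 v * yco 0 v);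
         (fun v => xco 0 v * yco 0 v + xco 1 v * yco 1 v)].

Definition ell_reg : 1.-tuple ('rV[R]_(1 + 1) -> R) :=
  [tuple (fun v => (xco 0 v ^+ 2 + yco 0 v ^+ 2) / 2)].

Definition has_normal_form (p : M) m k (q : k.-tuple ('rV[R]_(m + m) -> R)) :
    Prop :=
  exists e : 'M[R]_(m + m, 4),
    symplectic_frame p e /\ slice_algebra p e = quadratic_span q.

(* for the orbit through [p] *)
Definition almost_toric (p : M) : Prop :=
  [/\ singular p, compact (orbit p), non_degenerate p &
      [\/ has_normal_form p ell_ell, has_normal_form p foc_foc |
          has_normal_form p ell_reg]].

Definition focus_focus (p : M) : Prop :=
  almost_toric p /\ has_normal_form p foc_foc.

(** ** Faithful semitoric systems *)

Definition proper_onto_image : Prop :=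
  forall K : set 'rV[R]_2, K `<=` range Phi -> compact K ->
    compact (Phi @^-1` K).

Definition critical_values_J : set R :=
  fstJ @` [set p | grad (fstJ \o param (chart_at p)) (chart (chart_at p) p) = 0].

(* The circle action is determined by J, as the flow of its Hamiltonian vector
   field, so that it may be quantified over existentially. *)
Definition faithful_semitoric : Prop :=
  [/\ integrable_system,
      connected [set: M],
      proper_onto_image,
      (forall p, singular p -> almost_toric p) &
      exists rho : 'rV[R]_1 -> M -> M,
      [/\ [/\ torus_action setT rho, effective setT rho &
              moment_map setT rho (fun p => \row_(_ < 1) fstJ p)],
          forall x, connected (fstJ @^-1` [set x]),
          forall x, range fstJ x -> ~ limit_point critical_values_J x &
          forall x, finite_set (fstJ @^-1` [set x] `&`
                                isolated [set p | forall t, rho t p = p])]].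

Definition at_most_one_ff_per_fiber : Prop :=
  forall p q, focus_focus p -> focus_focus q -> Phi p = Phi q -> p = q.

(** ** Cartographic pairs *)

Definition Bimg : set 'rV[R]_2 := range Phi.
Definition Bff : set 'rV[R]_2 := Phi @` focus_focus.
Definition Bwt : set 'rV[R]_2 := Bimg `\` Bff.

(* The domains of the charts are taken to be connected: on a disconnected
   domain, effectiveness of the torus action would not pass to the components,
   and the transition maps would not be in AGL(2;Z). *)
Definition affine_chart (U : set 'rV[R]_2) (psi : 'rV[R]_2 -> 'rV[R]_2) :
    Prop :=
  [/\ exists O, open O /\ U = O `&` Bwt,
      connected U,
      smooth_embedding U psi &
      exists rho : 'rV[R]_2 -> M -> M,
        [/\ torus_action (Phi @^-1` U) rho, effective (Phi @^-1` U) rho &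
            moment_map (Phi @^-1` U) rho (psi \o Phi)]].

(* For each chart psi, f o psi^-1 is locally on psi(U `&` S) the restriction of
   an element of AGL(2;Z). *)
Definition Z_affine (S : set 'rV[R]_2) (f : 'rV[R]_2 -> 'rV[R]_2) : Prop :=
  forall U psi, affine_chart U psi ->
  forall z, (U `&` S) z ->
  exists (O : set 'rV[R]_2) (A : 'M[int]_2) (b : 'rV[R]_2),
    [/\ open O, O (psi z), A \in unitmx &
        forall w, (U `&` S) w -> O (psi w) ->
          f w = psi w *m map_mx intr A + b].

Definition cartographic_pair (f : 'rV[R]_2 -> 'rV[R]_2) (S : set 'rV[R]_2) :
    Prop :=
  [/\ topological_embedding Bimg f,
      S `<=` Bwt,
      (exists O, open O /\ S = O `&` Bimg) /\ Bimg `<=` closure S,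
      smooth_embedding S f & Z_affine S f].

(* Only the values of [eps] on [Bff] matter. *)
Definition sign_choice (eps : 'rV[R]_2 -> R) : Prop :=
  forall c, Bff c -> eps c = 1 \/ eps c = -1.

Definition cut (eps : 'rV[R]_2 -> R) (c : 'rV[R]_2) : set 'rV[R]_2 :=
  [set z : 'rV[R]_2 | z 0 0 = c 0 0 /\ eps c * c 0 1 <= eps c * z 0 1]
  `&` Bimg.

Definition S_eps (eps : 'rV[R]_2 -> R) : set 'rV[R]_2 :=
  Bimg `\` \bigcup_(c in Bff) cut eps c.

Definition j_eps (eps : 'rV[R]_2 -> R) (z : 'rV[R]_2) : R :=
  \sum_(c \in [set c | Bff c /\ cut eps c z]) eps c.

Definition left_of (z : 'rV[R]_2) : set 'rV[R]_2 := [set w : 'rV[R]_2 | w 0 0 < z 0 0].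
Definition right_of (z : 'rV[R]_2) : set 'rV[R]_2 := [set w : 'rV[R]_2 | z 0 0 < w 0 0].

Definition shear (s : R) : 'M[R]_2 := 1%:M + s *: delta_mx 1 0.

(* [s] is sgn(f); the second item below is the wall-crossing condition. *)
Definition semitoric_cartographic (eps : 'rV[R]_2 -> R)
    (f : 'rV[R]_2 -> 'rV[R]_2) : Prop :=
  [/\ sign_choice eps,
      cartographic_pair f (S_eps eps),
      forall z, Bimg z -> f z 0 0 = z 0 0 &
      exists s : R,
        (forall z, S_eps eps z -> Num.sg (Dsub (S_eps eps) f z 1 1) = s) /\
        forall z, Bwt z ->
          closure (Bimg `&` left_of z) z -> closure (Bimg `&` right_of z) z ->
          exists Ll Lr : 'M[R]_2,
            [/\ Dsub (S_eps eps) f w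
                  @[w --> within (S_eps eps `&` left_of z) (nbhs z)] --> Ll,
                Dsub (S_eps eps) f w
                  @[w --> within (S_eps eps `&` right_of z) (nbhs z)] --> Lr &
                Ll = shear (s * j_eps eps z) *m Lr]].

Definition semitoric_images : set (set 'rV[R]_2) :=
  [set P | exists eps f, semitoric_cartographic eps f /\ P = f @` Bimg].

End Systems.

(** ** Strict isomorphisms *)

Section Isomorphisms.
Context {R : realType}.

Definition symplectomorphism (M N : symplectic4 R) (Psi : M -> N) : Prop :=
  diffeomorphism Psi /\
  forall (i : idx M) (j : idx N) (p : M), dom i p -> dom j (Psi p) ->
    let T := jacobian (chart j \o Psi \o param i) (chart i p) in
    om i (chart i p) = T *m om j (chart j (Psi p)) *m T^T.

Definition strictly_isomorphic (M1 M2 : symplectic4 R)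
    (Phi1 : M1 -> 'rV[R]_2) (Phi2 : M2 -> 'rV[R]_2) : Prop :=
  exists (Psi : M1 -> M2) (psi : 'rV[R]_2 -> 'rV[R]_2),
    [/\ symplectomorphism Psi,
        smooth_embedding (Bimg Phi1) psi /\ psi @` Bimg Phi1 = Bimg Phi2,
        forall z, Bimg Phi1 z -> psi z 0 0 = z 0 0 &
        forall p, Phi2 (Psi p) = psi (Phi1 p)].

End Isomorphisms.

(* Main.v *)
From HB Require Import structures.
Require Import Defs.
From mathcomp Require Import all_boot all_order all_algebra.
From mathcomp Require Import all_classical all_reals all_analysis.
From mathcomp Require Import ring lra.

(** An isomorphism (Psi, psi) transports semitoric cartographic pairs backwards,
    by (eps, f) |-> (s * eps \o psi, f \o psi), without changing the image, where
    s is the sign of the y-derivative of the second component of psi.  This sign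
    is constant because B is connected and that derivative never vanishes; since
    the vertical slices of B are segments, psi is monotone on them in the
    direction s, so the cuts correspond.  Multiplying sgn f and every eps by s
    leaves the product sgn f * j_eps of the wall-crossing condition unchanged.

    The Z-affine structures correspond because Psi conjugates torus actions.  For
    these actions to live on open sets, the focus-focus values must form a
    relatively closed set: a focus-focus point is fixed by the circle action, and
    it is isolated among the fixed points because the linearization of the vector
    field of J there is invertible, so (F5) and (F6) apply.

    Derivatives on subsets of B do not depend on the local extension: two
    extensions have the same composite with Phi, hence the same differential at
    regular values, and these are dense.  No openness of B is involved. *)

(** The isomorphism is packaged symmetrically in the two systems, so that one inclusion between the
    sets of images suffices. Focus-focus points correspond because [Phi] has rank 0 there: second
    derivatives of [psi] do not enter, and the linearization for [a . Phi2] is conjugate to the one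
    for [(a D psi) . Phi1], so the algebra formed by all of them is the same up to a change of
    frame. The linearization for J is invertible because of the shape of the normal form: the
    combination of the two focus-focus forms with coefficients a and b is degenerate only if a^2 +
    b^2 = 0. In the wall-crossing condition the shear multiplies [D f] on the left, whereas the
    chain rule puts [D psi] on the right; being continuous across the wall, [D psi] is a common
    factor of both one-sided limits. *)

Set Implicit Arguments.
Unset Strict Implicit.
Unset Printing Implicit Defensive.

Import Order.TTheory GRing.Theory Num.Theory.
Import numFieldNormedType.Exports.

Local Open Scope classical_set_scope.
Local Open Scope ring_scope.

(** * Smooth maps between normed modules *)

Section CkCalculus.
Context {R : realType}.
Implicit Types V W Z : normedModType R.

(** The first-order expansion depends only on the germ. It is stated for [g] with the differential
    of [f], so that uniqueness of the differential applies before [g] is known to be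
    differentiable. *)
Lemma near_eq_diff_loc V W (f g : V -> W) x : (\near x, f x = g x) ->
  differentiable f x ->
  continuous ('d f x) /\ g \o shift x = cst (g x) + 'd f x +o_ 0 id.
Proof.
move=> fg df; have [dc _] := (diff_locallyP x f).1 df; split => //.
apply/eqaddoP => e e0.
have [_ /eqaddoP/(_ e e0)] := (diff_locallyP x f).1 df.
rewrite (nbhs_singleton fg); apply: filter_app.
have : \forall h \near 0, f (h + x) = g (h + x).
  by move: fg; rewrite (near_shift 0 x) /= subr0.
apply: filterS => h E.
by rewrite !fctE /= -E.
Qed.

Lemma near_eq_diff V W (f g : V -> W) x : (\near x, f x = g x) ->
  differentiable f x -> 'd g x = 'd f x :> (V -> W).
Proof. by move=> fg df; apply/diff_unique; have [] := near_eq_diff_loc fg df. Qed.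

Lemma near_eq_differentiable V W (f g : V -> W) x : (\near x, f x = g x) ->
  differentiable f x -> differentiable g x.
Proof.
move=> fg df; apply/diff_locallyP.
by rewrite (near_eq_diff fg df); exact: near_eq_diff_loc.
Qed.

(** [Ck] tests [f] only at points of [U], but each test looks at an ambient neighborhood of the
    point, so it keeps its content on a singleton. Restriction and gluing thereby become pointwise
    matters. *)
Lemma CkP V W k (U : set V) (f : V -> W) :
  Ck k U f <-> forall x, U x -> Ck k [set x] f.
Proof.
elim: k f => [|k IH] f /=.
  by split=> [h x Ux _ -> | h x Ux]; [exact: h | exact: (h x Ux x)].
split=> [[df dk] x Ux | h].
  by split=> [_ -> | v]; [exact: df | exact: (IH _).1 (dk v) x Ux].
split=> [x Ux | v]; first exact: (h x Ux).1.
by apply/IH => x Ux; exact: (h x Ux).2.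
Qed.

Lemma Ck_sub V W k (U U' : set V) (f : V -> W) :
  U' `<=` U -> Ck k U f -> Ck k U' f.
Proof. by move=> UU /CkP h; apply/CkP => x /UU/h. Qed.

Lemma Ck_eq V W k (U : set V) (f g : V -> W) : open U ->
  {in U, f =1 g} -> Ck k U f -> Ck k U g.
Proof.
move=> oU; elim: k f g => [|k IH] f g fg /=.
  move=> h x Ux; apply: (cvg_trans _ (cvg_trans (h x Ux) _)).
    apply: near_eq_cvg; apply: filterS (open_nbhs_nbhs (conj oU Ux)) => y Uy.
    by rewrite fg ?inE.
  by rewrite fg ?inE.
have fgn x : U x -> \near x, f x = g x.
  by move=> Ux; apply: filterS (open_nbhs_nbhs (conj oU Ux)) => y Uy; rewrite fg ?inE.
move=> [df dk]; split=> [x Ux|v].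
  by apply: near_eq_differentiable (df x Ux); exact: fgn.
by apply: IH (dk v) => x /[!inE] Ux; exact/near_eq_derive/fgn.
Qed.

Lemma Ck_continuous V W k (U : set V) (f : V -> W) x : Ck k U f -> U x ->
  {for x, continuous f}.
Proof.
case: k => [|k] /=; first by move=> h /h.
by case=> df _ /df; exact: differentiable_continuous.
Qed.

Lemma CkS V W k (U : set V) (f : V -> W) : Ck k.+1 U f -> Ck k U f.
Proof.
elim: k f => [|k IH] f.
  by move=> h x Ux; exact: Ck_continuous h Ux.
by move=> [df dk]; split=> // v; exact/IH/dk.
Qed.

Lemma CkD V W k (U : set V) (f g : V -> W) : open U ->
  Ck k U f -> Ck k U g -> Ck k U (f \+ g).
Proof.
move=> oU; elim: k f g => [|k IH] f g.
  by move=> hf hg x Ux; apply: cvgD; [exact: hf | exact: hg].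
move=> [df dkf] [dg dkg]; split=> [x Ux|v].
  by apply: differentiableD; [exact: df | exact: dg].
apply: Ck_eq (IH _ _ (dkf v) (dkg v)) => // x /[!inE] Ux /=.
by rewrite deriveD //; apply: diff_derivable; [exact: df|exact: dg].
Qed.

Lemma Ck_cst V W k (U : set V) (w : W) : Ck k U (cst w : V -> W).
Proof.
elim: k w => [|k IH] w; first by move=> x _; exact: cvg_cst.
split=> [x _|v]; first exact: differentiable_cst.
have -> : 'D_v (cst w : V -> W) = cst 0 by apply/funext => x; rewrite derive_cst.
exact: IH.
Qed.

Lemma Ck_sum V W k (U : set V) (I : Type) (r : seq I) (f : I -> V -> W) : open U ->
  (forall i, Ck k U (f i)) -> Ck k U (fun x => \sum_(i <- r) f i x).
Proof.
move=> oU h; elim: r => [|i r IH].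
  by apply: Ck_eq (Ck_cst k U 0) => // x _; rewrite big_nil.
apply: Ck_eq (CkD oU (h i) IH) => // x _.
by rewrite big_cons.
Qed.

Lemma Ck_lin V W Z k (U : set V) (f : V -> W) (c : {linear W -> Z}) : open U ->
  continuous c -> Ck k U f -> Ck k U (c \o f).
Proof.
move=> oU cc; elim: k f => [|k IH] f.
  by move=> h x Ux; apply: continuous_comp; [exact: h | exact: cc].
have dc y : differentiable c y by exact: linear_differentiable.
move=> [df dk]; split=> [x Ux|v].
  by apply: differentiable_comp => //; exact: df.
apply: Ck_eq (IH _ (dk v)) => // x /[!inE] Ux /=.
have dfx := df x Ux.
have dcf : differentiable (c \o f) x by exact: differentiable_comp.
by rewrite (deriveE _ dcf) diff_comp //= diff_lin // deriveE.
Qed.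

Lemma scaler_is_bilinear W :
  bilinear_for
    (GRing.Scale.Law.clone _ _ *:%R _) (GRing.Scale.Law.clone _ _ *:%R _)
    (@GRing.scale R W : R -> W -> W).
Proof.
split => [u'|u] a x y /=; first by rewrite scalerDl scalerA.
by rewrite scalerDr !scalerA mulrC.
Qed.

Lemma is_diff_scale V W (a : V -> R) (h : V -> W) x :
  differentiable a x -> differentiable h x ->
  is_diff x (fun y => a y *: h y) (fun v => a x *: 'd h x v + 'd a x v *: h x).
Proof.
move=> da dh.
pose blM := bilinear_isBilinear.Build R R W W _ _ (@GRing.scale R W : R -> W -> W)
  (scaler_is_bilinear W).
pose bl : {bilinear R -> W -> W} := HB.pack (@GRing.scale R W : R -> W -> W) blM.
have cbl : continuous (fun p : R * W => bl p.1 p.2).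
  by move=> p; exact: scale_continuous.
have db p := differentiable_bilin p cbl.
have dp : differentiable (fun y => (a y, h y)) x by exact: differentiable_pair.
have E : (fun y => a y *: h y) = (fun p : R * W => bl p.1 p.2) \o (fun y => (a y, h y)).
  by [].
rewrite E; apply: DiffDef; first exact: differentiable_comp.
by rewrite diff_comp // diff_bilin // diff_pair.
Qed.

Lemma Ck_scale V W k (U : set V) (a : V -> R) (h : V -> W) : open U ->
  Ck k U a -> Ck k U h -> Ck k U (fun y => a y *: h y).
Proof.
move=> oU; elim: k a h => [|k IH] a h.
  by move=> ca ch x Ux; apply: cvgZ; [exact: ca | exact: ch].
move=> ca ch; have [da dka] := ca; have [dh dkh] := ch.
have D x : U x -> is_diff x (fun y => a y *: h y)
    (fun v => a x *: 'd h x v + 'd a x v *: h x).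
  by move=> Ux; apply: is_diff_scale; [exact: da | exact: dh].
split=> [x Ux|v]; first by have := D x Ux.
apply: Ck_eq (CkD oU (IH _ _ (CkS ca) (dkh v)) (IH _ _ (dka v) (CkS ch))) => //.
move=> x /[!inE] Ux /=; have Dx := D x Ux.
rewrite [RHS]deriveE ?diff_val; last exact: ex_diff.
by rewrite !deriveE; [| exact: da | exact: dh].
Qed.

(* The composition rule expands 'D_w g in coordinates of w; this form of finite
   dimension covers both 'rV[R]_n and products of such spaces. *)
Definition finite_frame W (I : finType) (e : I -> W) (c : I -> {linear W -> R}) :=
  (forall i, continuous (c i)) /\ forall w, w = \sum_i c i w *: e i.

Lemma Ck_comp V W Z (I : finType) (e : I -> W) (c : I -> {linear W -> R})
    k (U : set V) (U' : set W) (f : V -> W) (g : W -> Z) :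
  finite_frame e c -> open U -> open U' -> (forall x, U x -> U' (f x)) ->
  Ck k U f -> Ck k U' g -> Ck k U (g \o f).
Proof.
move=> [cc ce] oU oU' fU; elim: k f g fU => [|k IH] f g fU.
  by move=> cf cg x Ux; apply: continuous_comp; [exact: cf | exact/cg/fU].
move=> cf cg; have [df dkf] := cf; have [dg dkg] := cg.
have D x : U x -> is_diff x (g \o f) ('d g (f x) \o 'd f x).
  move=> Ux; have ? := df x Ux; have ? := dg _ (fU x Ux).
  by apply: DiffDef; [exact: differentiable_comp | rewrite diff_comp].
split=> [x Ux|v]; first by have [] := D x Ux.
(* The summands of the chain rule: coordinates of ['D_v f] times the partial derivatives of [g]
   along [f]. The latter are handled by induction, after one order of [f] is given up. *)
have S i : Ck k U (fun x => c i ('D_v f x) *: ('D_(e i) g \o f) x).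
  apply: Ck_scale => //; first exact: (Ck_lin oU (cc i) (dkf v)).
  by apply: IH => //; [exact: CkS cf | exact: dkg].
apply: Ck_eq (Ck_sum (index_enum I) oU S) => // x /[!inE] Ux /=.
have Dx := D x Ux.
rewrite [RHS]deriveE ?diff_val /=; last exact: ex_diff.
rewrite [in RHS](ce ('d f x v)) linear_sum /=; apply: eq_bigr => i _.
rewrite linearZ /= deriveE; last exact: df.
by rewrite deriveE //; exact/dg/fU.
Qed.

Lemma coord_linear m n (i : 'I_m) (j : 'I_n) :
  linear (fun N : 'M[R]_(m, n) => N i j : R).
Proof. by move=> a M N; rewrite !mxE. Qed.

Definition coordl m n (i : 'I_m) (j : 'I_n) : {linear 'M[R]_(m, n) -> R} :=
  HB.pack (fun N : 'M[R]_(m, n) => N i j : R)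
    (GRing.isLinear.Build _ _ _ _ _ (@coord_linear m n i j)).

Lemma finite_frame_rV n : finite_frame (fun j : 'I_n => delta_mx 0 j : 'rV[R]_n)
  (fun j => coordl 0 j).
Proof.
split=> [i|w]; first exact: coord_continuous.
exact: row_sum_delta.
Qed.

Lemma fst_linear V W : linear (fst : V * W -> V).
Proof. by []. Qed.

Lemma snd_linear V W : linear (snd : V * W -> W).
Proof. by []. Qed.

Definition fstl V W : {linear (V * W)%type -> V} :=
  HB.pack (fst : V * W -> V) (GRing.isLinear.Build _ _ _ _ _ (@fst_linear V W)).

Definition sndl V W : {linear (V * W)%type -> W} :=
  HB.pack (snd : V * W -> W) (GRing.isLinear.Build _ _ _ _ _ (@snd_linear V W)).

Lemma finite_frame_pair V W (I J : finType) (e : I -> V) (c : I -> {linear V -> R})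
    (e' : J -> W) (c' : J -> {linear W -> R}) :
  finite_frame e c -> finite_frame e' c' ->
  finite_frame
    (fun k : I + J => match k with inl i => (e i, 0) | inr j => (0, e' j) end : V * W)
    (fun k : I + J => match k with
       | inl i => (c i \o fstl V W : {linear _ -> _})
       | inr j => (c' j \o sndl V W : {linear _ -> _}) end).
Proof.
move=> [cc ce] [cc' ce']; split=> [[i|j] p|[v w]].
- by apply: continuous_comp; [exact: cvg_fst | exact: cc].
- by apply: continuous_comp; [exact: cvg_snd | exact: cc'].
rewrite big_sumType /=.
rewrite {1}(ce v) {1}(ce' w).
rewrite (eq_bigr (fun i => (c i v *: e i, 0))); last first.
  by move=> i _; congr pair; rewrite scaler0.
rewrite [X in _ + X](eq_bigr (fun j => (0, c' j w *: e' j))); last first.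
  by move=> i _; congr pair; rewrite scaler0.
have E1 (r : seq I) : \sum_(i <- r) ((c i v *: e i, 0) : V * W) =
    (\sum_(i <- r) c i v *: e i, 0).
  by elim/big_rec2: _ => // i y1 y2 _ ->; congr pair; rewrite addr0.
have E2 (r : seq J) : \sum_(i <- r) ((0, c' i w *: e' i) : V * W) =
    (0, \sum_(i <- r) c' i w *: e' i).
  by elim/big_rec2: _ => // i y1 y2 _ ->; congr pair; rewrite addr0.
by rewrite E1 E2; congr pair; rewrite ?addr0 ?add0r.
Qed.

Lemma smooth_comp_rV V Z n (U : set V) (U' : set 'rV[R]_n) (f : V -> 'rV[R]_n)
    (g : 'rV[R]_n -> Z) :
  open U -> open U' -> (forall x, U x -> U' (f x)) ->
  smooth_open U f -> smooth_open U' g -> smooth_open U (g \o f).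
Proof. by move=> oU oU' fU sf sg k; exact: (Ck_comp (finite_frame_rV n) oU oU'). Qed.

Lemma smooth_comp_pair V Z m n (U : set V) (U' : set ('rV[R]_m * 'rV[R]_n))
    (f : V -> 'rV[R]_m * 'rV[R]_n) (g : 'rV[R]_m * 'rV[R]_n -> Z) :
  open U -> open U' -> (forall x, U x -> U' (f x)) ->
  smooth_open U f -> smooth_open U' g -> smooth_open U (g \o f).
Proof.
move=> oU oU' fU sf sg k.
exact: (Ck_comp (finite_frame_pair (finite_frame_rV m) (finite_frame_rV n)) oU oU').
Qed.

Lemma smooth_local V W (U : set V) (f : V -> W) :
  (forall x, U x -> exists U' g, [/\ open U', U' x, smooth_open U' g &
     forall z, U' z -> g z = f z]) -> smooth_open U f.
Proof.
move=> h k; apply/CkP => x /h[U' [g [oU' U'x sg E]]].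
apply: (@Ck_sub _ _ _ U'); first by move=> _ ->.
by apply: Ck_eq (sg k) => // z /[!inE]; exact: E.
Qed.

Lemma smooth_sub V W (U U' : set V) (f : V -> W) :
  U' `<=` U -> smooth_open U f -> smooth_open U' f.
Proof. by move=> UU sf k; exact: Ck_sub (sf k). Qed.

Lemma smooth_eq V W (U : set V) (f g : V -> W) : open U ->
  {in U, f =1 g} -> smooth_open U f -> smooth_open U g.
Proof. by move=> oU fg sf k; exact: Ck_eq (sf k). Qed.

Lemma smooth_lin V W (U : set V) (c : {linear V -> W}) : open U ->
  continuous c -> smooth_open U c.
Proof.
move=> oU cc [|k] /=; first by move=> x _; exact: cc.
have dc y : differentiable c y by exact: linear_differentiable.
split=> [x _|v]; first exact: dc.
have -> : 'D_v c = cst (c v); last exact: Ck_cst.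
by apply/funext => x; rewrite deriveE // diff_lin.
Qed.

Lemma smooth_pair V W Z (U : set V) (f : V -> W) (g : V -> Z) : open U ->
  smooth_open U f -> smooth_open U g -> smooth_open U (fun x => (f x, g x)).
Proof.
move=> oU sf sg k; move: (sf k) (sg k) => {sf sg}.
elim: k f g => [|k IH] f g.
  by move=> cf cg x Ux; apply: cvg_pair; [exact: cf | exact: cg].
move=> [df dkf] [dg dkg].
have D x : U x -> is_diff x (fun x => (f x, g x)) (fun v => ('d f x v, 'd g x v)).
  move=> Ux; have ? := df x Ux; have ? := dg x Ux.
  by apply: DiffDef; [exact: differentiable_pair | rewrite diff_pair].
split=> [x Ux|v]; first by have [] := D x Ux.
apply: Ck_eq (IH _ _ (dkf v) (dkg v)) => // x /[!inE] Ux /=.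
have [? Dx] := D x Ux; rewrite [RHS]deriveE // Dx.
by rewrite !deriveE; [| exact: dg | exact: df].
Qed.

Lemma smooth_open_differentiable V W (U : set V) (f : V -> W) x :
  smooth_open U f -> U x -> differentiable f x.
Proof. by move=> /(_ 1)[df _] /df. Qed.

Lemma smooth_open_continuous V W (U : set V) (f : V -> W) x :
  smooth_open U f -> U x -> {for x, continuous f}.
Proof. by move=> /(_ 0) h /h. Qed.

Lemma smooth_derive V W (U : set V) (f : V -> W) v :
  smooth_open U f -> smooth_open U ('D_v f).
Proof. by move=> sf k; have [_ h] := sf k.+1; exact: h. Qed.

Lemma smooth_coord V m n (U : set V) (f : V -> 'M[R]_(m, n)) i j : open U ->
  smooth_open U f -> smooth_open U (fun x => f x i j).
Proof.
move=> oU sf k; apply: (Ck_lin (c := coordl i j) oU _ (sf k)).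
exact: coord_continuous.
Qed.

Lemma jacobian_comp m n p (f : 'rV[R]_m -> 'rV[R]_n) (g : 'rV[R]_n -> 'rV[R]_p) x :
  differentiable f x -> differentiable g (f x) ->
  jacobian (g \o f) x = jacobian f x *m jacobian g (f x).
Proof.
move=> df dg; apply/row_matrixP => i.
by rewrite rowE !rowE mulmxA !mul_rV_lin1 /= diff_comp.
Qed.

Lemma jacobianE m n (f : 'rV[R]_m -> 'rV[R]_n) x i j : differentiable f x ->
  jacobian f x i j = ('D_(delta_mx 0 i) f x) 0 j.
Proof. by move=> df; rewrite deriveEjacobian // -rowE [RHS]mxE. Qed.

Lemma near_eq_jacobian m n (f g : 'rV[R]_m -> 'rV[R]_n) x :
  (\near x, f x = g x) -> differentiable f x -> jacobian g x = jacobian f x.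
Proof.
move=> fg df.
have E := near_eq_diff fg df.
unfold jacobian.
refine (congr1 (@lin1_mx _ _ _) _).
exact: E.
Qed.

Lemma open_eq_jacobian m n (U : set 'rV[R]_m) (f g : 'rV[R]_m -> 'rV[R]_n) x :
  open U -> U x -> (forall y, U y -> f y = g y) -> differentiable f x ->
  jacobian g x = jacobian f x.
Proof.
move=> oU Ux fg; apply: near_eq_jacobian.
by apply: filterS (open_nbhs_nbhs (conj oU Ux)) => y /fg.
Qed.

Lemma smooth_jacobian m n (U : set 'rV[R]_m) (f : 'rV[R]_m -> 'rV[R]_n) i j :
  open U -> smooth_open U f -> smooth_open U (fun x => jacobian f x i j).
Proof.
move=> oU sf; apply: smooth_eq (smooth_coord 0 j oU (smooth_derive (delta_mx 0 i) sf)) => //.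
by move=> x /[!inE] Ux; rewrite jacobianE //; exact: smooth_open_differentiable sf Ux.
Qed.

Lemma jacobian_id n (x : 'rV[R]_n) : jacobian id x = 1%:M.
Proof.
apply/row_matrixP => i; rewrite 2!rowE mulmx1 mul_rV_lin1 /=.
by have [_ ->] := is_diff_id x.
Qed.

Lemma cvg_mx (T : Type) (F : set_system T) m n (f : T -> 'M[R]_(m, n))
    (l : 'M[R]_(m, n)) : Filter F ->
  (forall i j, f t i j @[t --> F] --> l i j) -> f t @[t --> F] --> l.
Proof.
move=> FF h; apply/cvgrPdist_le => /= e e0.
near=> x; rewrite /Num.Def.normr/= mx_normrE (bigmax_le _ (ltW e0))//= => i _.
rewrite !mxE /=; move: i; near: x; apply: filter_forall => /= i.
exact: (cvgrPdist_le _ _).1 (h i.1 i.2) e e0.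
Unshelve. all: by end_near. Qed.

Lemma cvg_mx_coord (T : Type) (F : set_system T) m n (f : T -> 'M[R]_(m, n))
    (l : 'M[R]_(m, n)) i j : Filter F ->
  f t @[t --> F] --> l -> f t i j @[t --> F] --> l i j.
Proof. by move=> FF h; exact: (cvg_comp _ _ h (@coord_continuous _ m n i j l)). Qed.

Lemma cvg_mulmx (T : Type) (F : set_system T) m n p (f : T -> 'M[R]_(m, n))
    (g : T -> 'M[R]_(n, p)) (a : 'M[R]_(m, n)) (b : 'M[R]_(n, p)) : Filter F ->
  f t @[t --> F] --> a -> g t @[t --> F] --> b ->
  f t *m g t @[t --> F] --> a *m b.
Proof.
move=> FF fa gb; apply: cvg_mx => i j; rewrite mxE.
under eq_fun do rewrite mxE.
apply: cvg_big => [|k _]; first exact: add_continuous.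
by apply: cvgM; exact: cvg_mx_coord.
Qed.

Lemma cvg_trmx (T : Type) (F : set_system T) m n (f : T -> 'M[R]_(m, n))
    (a : 'M[R]_(m, n)) : Filter F -> f t @[t --> F] --> a -> (f t)^T @[t --> F] --> a^T.
Proof.
move=> FF fa; apply: cvg_mx => i j; rewrite mxE.
under eq_fun do rewrite mxE.
exact: cvg_mx_coord.
Qed.

End CkCalculus.

(** * Symplectic maps in charts *)

Section Charts.
Context {R : realType}.
Implicit Types M N : manifold4 R.

Lemma chart_image_setI M (i : idx M) (W : set M) :
  chart i @` (dom i `&` W) = (chart i @` dom i) `&` (param i @^-1` W).
Proof.
apply/seteqP; split=> [x [p [dp Wp] <-]|x [[p dp <-]]] /=.
  by rewrite chartK //; split=> //; exists p.
by rewrite chartK // => Wp; exists p.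
Qed.

Lemma open_setI_preimage (T S : topologicalType) (A : set T) (f : T -> S) (W : set S) :
  open A -> (forall x, A x -> {for x, continuous f}) -> open W ->
  open (A `&` f @^-1` W).
Proof.
move=> oA cf oW; rewrite openE => x [Ax Wx].
apply: filterI; first by apply: open_nbhs_nbhs.
by apply: cf => //; apply: open_nbhs_nbhs.
Qed.

Lemma open_chart_image M (i : idx M) (W : set M) :
  open W -> open (chart i @` (dom i `&` W)).
Proof.
move=> oW; rewrite chart_image_setI; apply: open_setI_preimage => //.
  exact: image_open.
by move=> x; exact: param_continuous.
Qed.

Lemma open_dom_preimage M N (Psi : M -> N) j : smooth_map Psi ->
  open (Psi @^-1` dom j).
Proof. by move=> [/continuousP cPsi _]; apply: cPsi; exact: dom_open. Qed.

Definition local_rep M N (Psi : M -> N) i j : 'rV[R]_4 -> 'rV[R]_4 :=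
  chart j \o Psi \o param i.

Definition rep_dom M N (Psi : M -> N) i j : set 'rV[R]_4 :=
  chart i @` (dom i `&` Psi @^-1` dom j).

Lemma rep_domE M N (Psi : M -> N) i j p :
  dom i p -> dom j (Psi p) -> rep_dom Psi i j (chart i p).
Proof. by move=> dp dq; exists p. Qed.

Lemma open_rep_dom M N (Psi : M -> N) i j : smooth_map Psi -> open (rep_dom Psi i j).
Proof. by move=> sPsi; apply/open_chart_image/open_dom_preimage. Qed.

Lemma local_repE M N (Psi : M -> N) i j p :
  dom i p -> local_rep Psi i j (chart i p) = chart j (Psi p).
Proof. by move=> dp; rewrite /local_rep /= chartK. Qed.

Lemma local_rep_differentiable M N (Psi : M -> N) i j p :
  smooth_map Psi -> dom i p -> dom j (Psi p) ->
  differentiable (local_rep Psi i j) (chart i p).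
Proof.
move=> [cPsi sPsi] dp dq; apply: smooth_open_differentiable (sPsi i j) _.
exact: rep_domE.
Qed.

(** The composite of the two representatives is the identity near [chart i p]. The factors stand in
    this order because differentials act on rows. *)
Lemma jacobian_local_rep_inv M N (Psi : M -> N) (Psi' : N -> M) i j p :
  smooth_map Psi -> smooth_map Psi' -> cancel Psi Psi' ->
  dom i p -> dom j (Psi p) ->
  jacobian (local_rep Psi i j) (chart i p) *m
  jacobian (local_rep Psi' j i) (chart j (Psi p)) = 1%:M.
Proof.
move=> sPsi sPsi' K dp dq.
have dq' : dom i (Psi' (Psi p)) by rewrite K.
have d1 := local_rep_differentiable sPsi dp dq.
have d2 := local_rep_differentiable sPsi' dq dq'.
rewrite -(local_repE Psi j dp) in d2 *.
rewrite -jacobian_comp // -[RHS](jacobian_id (chart i p)).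
apply: (@open_eq_jacobian _ _ _ (rep_dom Psi i j)).
- exact: open_rep_dom.
- exact: rep_domE.
- by move=> _ [q [dq1 dq2] <-]; rewrite /local_rep /= !chartK // K.
- by have [] := is_diff_id (chart i p).
Qed.

End Charts.

(** * Naturality of Hamiltonian vector fields and integral curves *)

Section Hamiltonian.
Context {R : realType}.

Lemma deriv_eq_jacobian_row m n (f : 'rV[R]_m -> 'rV[R]_n) x a :
  differentiable f x -> 'D_(delta_mx 0 a) f x = row a (jacobian f x).
Proof. by move=> df; rewrite deriveEjacobian // rowE. Qed.

Lemma grad_comp (h : 'rV[R]_4 -> R) (tau : 'rV[R]_4 -> 'rV[R]_4) x :
  differentiable tau x -> differentiable h (tau x) ->
  grad (h \o tau) x = grad h (tau x) *m (jacobian tau x)^T.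
Proof.
move=> dt dh; apply/rowP => a; rewrite !mxE.
rewrite deriveE; last exact: differentiable_comp.
rewrite diff_comp //= -[X in 'd h _ X](deriveE _ dt) deriv_eq_jacobian_row //.
rewrite [in LHS](row_sum_delta (row a (jacobian tau x))) linear_sum.
apply: eq_bigr => b _; rewrite linearZ /= mulrC -deriveE // mxE.
by rewrite /GRing.scale /=; congr (_ * _); rewrite [RHS]mxE.
Qed.

Lemma open_eq_grad (U : set 'rV[R]_4) (f g : 'rV[R]_4 -> R) x :
  open U -> U x -> (forall y, U y -> f y = g y) -> grad f x = grad g x.
Proof.
move=> oU Ux fg; apply/rowP => a; rewrite !mxE.
apply: near_eq_derive; apply: filterS (open_nbhs_nbhs (conj oU Ux)) => y.
exact: fg.
Qed.

Lemma smooth_map_rep (M N : manifold4 R) (Psi : M -> N) i j : smooth_map Psi ->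
  smooth_open (rep_dom Psi i j) (local_rep Psi i j).
Proof. by case=> _; exact. Qed.

Definition symplectic_map (M N : symplectic4 R) (Psi : M -> N) : Prop :=
  forall i j p, dom i p -> dom j (Psi p) ->
    let T := jacobian (local_rep Psi i j) (chart i p) in
    om i (chart i p) = T *m om j (chart j (Psi p)) *m T^T.

Lemma symplectic_map_inv (M N : symplectic4 R) (Psi : M -> N) (Psi' : N -> M) :
  smooth_map Psi -> smooth_map Psi' -> cancel Psi Psi' -> cancel Psi' Psi ->
  symplectic_map Psi -> symplectic_map Psi'.
Proof.
move=> s1 s2 K K' sy j i q dq dp /=.
have dq' : dom j (Psi (Psi' q)) by rewrite K'.
have := sy i j (Psi' q) dp dq'; rewrite /= K'.
have := jacobian_local_rep_inv s2 s1 K' dq dp.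
move: (jacobian _ _) => T'; move: (jacobian _ _) => T TT ->.
by rewrite !mulmxA TT mul1mx -!mulmxA -trmx_mul TT trmx1 mulmx1.
Qed.

(** The pulled back form [T *m om *m T^T] is invertible, hence so is its factor [T]. *)
Lemma jacobian_symplectic_unit (M N : symplectic4 R) (Psi : M -> N) i j p :
  symplectic_map Psi -> dom i p -> dom j (Psi p) ->
  jacobian (local_rep Psi i j) (chart i p) \in unitmx.
Proof.
move=> sy dp dq; have := @om_nondegenerate _ M i (chart i p).
rewrite (sy i j p dp dq) => /(_ (ex_intro2 _ _ p dp erefl)).
by rewrite !unitmx_mul => /andP[/andP[]].
Qed.

Lemma invmx_mul n (A B : 'M[R]_n.+1) : A \in unitmx -> B \in unitmx ->
  invmx (A *m B) = invmx B *m invmx A.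
Proof. exact: invrM. Qed.

(** The gradient contributes [T^T] on the right, which cancels against the inverse of the pulled
    back form; that inverse ends in [T^-1], which the differential of [Psi] cancels. *)
Lemma hamvec_natural (M N : symplectic4 R) (Psi : M -> N) (F : N -> R) i j p :
  smooth_map Psi -> symplectic_map Psi -> dom i p -> dom j (Psi p) ->
  differentiable (F \o param j) (chart j (Psi p)) ->
  hamvec (F \o Psi) i (chart i p) *m jacobian (local_rep Psi i j) (chart i p) =
  hamvec F j (chart j (Psi p)).
Proof.
move=> sPsi sy dp dq dF; rewrite /hamvec.
have dt := local_rep_differentiable sPsi dp dq.
have Tu := jacobian_symplectic_unit sy dp dq.
have omu : om j (chart j (Psi p)) \in unitmx.
  by apply: om_nondegenerate; exists (Psi p).
have -> : grad ((F \o Psi) \o param i) (chart i p) =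
    grad ((F \o param j) \o local_rep Psi i j) (chart i p).
  apply: (@open_eq_grad (rep_dom Psi i j)); first exact: open_rep_dom.
    exact: rep_domE.
  by move=> _ [q [dq1 dq2] <-]; rewrite /local_rep /= !chartK.
rewrite grad_comp // ?local_repE // (sy i j p dp dq) /=.
move: (jacobian _ _) Tu => T Tu.
rewrite !invmx_mul ?unitmx_mul ?unitmx_tr ?Tu ?omu //.
rewrite -!mulmxA mulVmx // mulmx1 !mulmxA; congr (_ *m _).
by rewrite -mulmxA mulmxV ?unitmx_tr // mulmx1.
Qed.

Lemma is_derive_local_rep m n (f : R -> 'rV[R]_m) (tau : 'rV[R]_m -> 'rV[R]_n) (t : R) v :
  is_derive (t : R^o) (1 : R^o) (f : R^o -> _) v -> differentiable tau (f t) ->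
  is_derive (t : R^o) (1 : R^o) (tau \o f : R^o -> _) (v *m jacobian tau (f t)).
Proof.
move=> [/derivable1_diffP df <-] dt.
have dc : differentiable (tau \o f : R^o -> _) (t : R^o) by exact: differentiable_comp.
apply: DeriveDef; first exact/derivable1_diffP.
apply: etrans (deriveE _ dc) _; apply: etrans (congr1 (@^~ 1) (diff_comp df dt)) _.
apply: etrans (congr1 (mulmx^~ _) (esym (deriveE _ df))).
by symmetry; exact: mul_rV_lin1.
Qed.

(** The set [W] is there because [F] will be a combination of components of a torus moment map,
    smooth only over a chart domain of the base. *)
Lemma integral_curve_natural (M N : symplectic4 R) (Psi : M -> N) (F : N -> R)
    (W : set N) gamma :
  smooth_map Psi -> symplectic_map Psi -> open W -> smooth_to W F ->
  (forall t, W (Psi (gamma t))) ->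
  integral_curve (F \o Psi) gamma -> integral_curve F (Psi \o gamma).
Proof.
move=> sPsi sy oW sF Wg [cg dg]; have [cPsi _] := sPsi.
split=> [t|t j dq]; first by apply: continuous_comp; [exact: cg | exact: cPsi].
pose p := gamma t; pose i := chart_at p.
have dp : dom i p by exact: dom_chart_at.
have dt := local_rep_differentiable sPsi dp dq.
have dF : differentiable (F \o param j) (chart j (Psi p)).
  apply: (smooth_open_differentiable (sF j)).
  by exists (Psi p) => //; split=> //; exact: Wg.
rewrite -(hamvec_natural sPsi sy dp dq dF).
apply: near_eq_is_derive (is_derive_local_rep (dg t i dp) dt).
have : \near t, dom i (gamma t).
  by apply: cg; apply: open_nbhs_nbhs; split=> //; exact: dom_open.
by apply: filterS => s ds; rewrite /= local_repE.
Qed.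

End Hamiltonian.

(** * Smoothness of matrix-valued maps *)

Section SmoothMatrices.
Context {R : realType}.
Implicit Types V : normedModType R.

Lemma smooth_cst V (W : normedModType R) (U : set V) (w : W) :
  smooth_open U (cst w : V -> W).
Proof. by move=> k; exact: Ck_cst. Qed.

Lemma smooth_sum V (W : normedModType R) (U : set V) (I : Type) (r : seq I)
    (f : I -> V -> W) : open U ->
  (forall i, smooth_open U (f i)) -> smooth_open U (fun x => \sum_(i <- r) f i x).
Proof. by move=> oU h k; apply: Ck_sum => // i; exact: h. Qed.

Lemma smooth_scale V (W : normedModType R) (U : set V) (a : V -> R) (h : V -> W) :
  open U -> smooth_open U a -> smooth_open U h ->
  smooth_open U (fun y => a y *: h y).
Proof. by move=> oU sa sh k; exact: Ck_scale. Qed.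

Lemma smooth_mul V (U : set V) (a h : V -> R) : open U ->
  smooth_open U a -> smooth_open U h -> smooth_open U (fun y => a y * h y).
Proof. exact: smooth_scale. Qed.

Lemma smooth_prod V (U : set V) (I : Type) (r : seq I) (f : I -> V -> R) : open U ->
  (forall i, smooth_open U (f i)) -> smooth_open U (fun x => \prod_(i <- r) f i x).
Proof.
move=> oU h; elim: r => [|i r IH].
  by apply: smooth_eq (@smooth_cst V R U 1) => // x _; rewrite big_nil.
by apply: smooth_eq (smooth_mul oU (h i) IH) => // x _; rewrite big_cons.
Qed.

(** Induction on the order: the derivative [- (f x)^-1 * ((f x)^-1 * 'D_v f x)] is built from
    functions already known to be of order [k]. *)
Lemma smooth_inv V (U : set V) (f : V -> R) : open U -> (forall x, U x -> f x != 0) ->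
  smooth_open U f -> smooth_open U (fun x => (f x)^-1).
Proof.
move=> oU f0 sf k; elim: k => [|k IH].
  by move=> x Ux; apply: cvgV; [exact: f0 | exact: sf 0%N x Ux].
have [df dkf] := sf k.+1.
split=> [x Ux|v]; first by apply: differentiableV; [exact: df | exact: f0].
have S : Ck k U (fun x => - (f x)^-1 * ((f x)^-1 * 'D_v f x)).
  apply: (Ck_scale (a := fun x => - (f x)^-1)) => //.
    by apply: Ck_eq (Ck_scale oU (@Ck_cst R V R k U (-1)) IH) => // x _; rewrite /= scaleN1r.
  exact: (Ck_scale oU IH (dkf v)).
apply: Ck_eq S => // x /[!inE] Ux.
rewrite [RHS]deriveV; [|exact: f0|exact/diff_derivable/df].
by rewrite /GRing.scale /= mulrA mulNr -expr2 exprVn.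
Qed.

Lemma smooth_mx V m n (U : set V) (A : V -> 'M[R]_(m, n)) : open U ->
  (forall i j, smooth_open U (fun x => A x i j)) -> smooth_open U A.
Proof.
move=> oU h.
have S : smooth_open U (fun x => \sum_i \sum_j A x i j *: (delta_mx i j : 'M[R]_(m, n))).
  apply: smooth_sum => // i; apply: smooth_sum => // j.
  exact: (smooth_scale oU (h i j) (smooth_cst U _)).
by apply: smooth_eq S => // x _; rewrite -matrix_sum_delta.
Qed.

Lemma smooth_mulmx V m n p (U : set V) (A : V -> 'M[R]_(m, n))
    (B : V -> 'M[R]_(n, p)) : open U ->
  smooth_open U A -> smooth_open U B -> smooth_open U (fun x => A x *m B x).
Proof.
move=> oU sA sB; apply: smooth_mx => // i j.
have S : smooth_open U (fun x => \sum_k A x i k * B x k j).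
  by apply: smooth_sum => // k; apply: smooth_mul => //; exact: smooth_coord.
by apply: smooth_eq S => // x _; rewrite mxE.
Qed.

Lemma smooth_trmx V m n (U : set V) (A : V -> 'M[R]_(m, n)) : open U ->
  smooth_open U A -> smooth_open U (fun x => (A x)^T).
Proof.
move=> oU sA; apply: smooth_mx => // i j.
by apply: smooth_eq (smooth_coord j i oU sA) => // x _; rewrite mxE.
Qed.

Lemma smooth_det V n (U : set V) (A : V -> 'M[R]_n) : open U ->
  (forall i j, smooth_open U (fun x => A x i j)) -> smooth_open U (fun x => \det (A x)).
Proof.
move=> oU sA; rewrite /determinant; apply: smooth_sum => // s.
by apply: smooth_mul => //; [exact: smooth_cst | apply: smooth_prod => // i].
Qed.

(** By Cramer's rule the inverse is the adjugate over the determinant, both polynomial in the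
    entries. *)
Lemma smooth_invmx V n (U : set V) (A : V -> 'M[R]_n) : open U ->
  (forall x, U x -> A x \in unitmx) ->
  (forall i j, smooth_open U (fun x => A x i j)) ->
  smooth_open U (fun x => invmx (A x)).
Proof.
move=> oU Au sA.
have S : smooth_open U (fun x => (\det (A x))^-1 *: \adj (A x)).
  apply: smooth_scale => //.
    apply: smooth_inv => //; last exact: smooth_det.
    by move=> x /Au; rewrite unitmxE unitfE.
  apply: smooth_mx => // i j.
  have S : smooth_open U (fun x => (-1) ^+ (j + i) * \det (row' j (col' i (A x)))).
    apply: smooth_mul => //; first exact: smooth_cst.
    apply: smooth_det => // k l.
    by apply: smooth_eq (sA (lift j k) (lift i l)) => // x _; rewrite !mxE.
  by apply: smooth_eq S => // x _; rewrite !mxE.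
by apply: smooth_eq S => // x /[!inE] /Au Ux; rewrite /invmx Ux.
Qed.

Lemma smooth_jacobian_mx m n (U : set 'rV[R]_m) (f : 'rV[R]_m -> 'rV[R]_n) :
  open U -> smooth_open U f -> smooth_open U (jacobian f).
Proof. by move=> oU sf; apply: smooth_mx => // i j; exact: smooth_jacobian. Qed.

Lemma derive_coord V m n (A : V -> 'M[R]_(m, n)) x v i j : differentiable A x ->
  ('D_v A x) i j = 'D_v (fun x => A x i j) x.
Proof. by move=> /diff_derivable dA; rewrite derive_mx // mxE. Qed.

Lemma derivable_coord V m n (A : V -> 'M[R]_(m, n)) x v i j : differentiable A x ->
  derivable (fun x => A x i j) x v.
Proof. by move=> dA; apply: (derivable_mxP A x v).1; exact: diff_derivable. Qed.

Lemma derive_mulmx V m n p (A : V -> 'M[R]_(m, n)) (B : V -> 'M[R]_(n, p)) x v :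
  differentiable A x -> differentiable B x ->
  differentiable (fun x => A x *m B x) x ->
  'D_v (fun x => A x *m B x) x = 'D_v A x *m B x + A x *m 'D_v B x.
Proof.
move=> dA dB dAB; apply/matrixP => i j; rewrite derive_coord // !mxE.
have -> : (fun x => (A x *m B x) i j) =
    \sum_(k < n) ((fun x => A x i k) * (fun x => B x k j)).
  by apply/funext => y; rewrite mxE fct_sumE.
rewrite derive_sum; last first.
  by move=> k; apply: derivableM; exact: derivable_coord.
rewrite -big_split /=; apply: eq_bigr => k _.
rewrite deriveM; [|exact: derivable_coord|exact: derivable_coord].
rewrite (derive_coord v i k dA) (derive_coord v k j dB) [LHS]addrC.
by congr (_ + _); rewrite /GRing.scale /= mulrC.
Qed.

End SmoothMatrices.

(** A strict isomorphism with both inverses as data. The inverse laws of [psi] and [psi'] on the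
    images follow from the two commutation fields, and the two one-sided fields, on the symplectic
    form and on the first coordinate, are recovered for the inverse. Hence every statement below can
    be applied in both directions. *)
Record fibered_iso (R : realType) (M1 M2 : symplectic4 R)
    (Phi1 : M1 -> 'rV[R]_2) (Phi2 : M2 -> 'rV[R]_2)
    (Psi : M1 -> M2) (Psi' : M2 -> M1) (psi psi' : 'rV[R]_2 -> 'rV[R]_2) : Prop :=
  FiberedIso {
    iso_smooth : smooth_map Psi;
    iso_smooth_inv : smooth_map Psi';
    isoK : cancel Psi Psi';
    isoVK : cancel Psi' Psi;
    iso_symplectic : symplectic_map Psi;
    iso_base_smooth : smooth_on (Bimg Phi1) psi;
    iso_base_smooth_inv : smooth_on (Bimg Phi2) psi';
    iso_commutes : forall p, Phi2 (Psi p) = psi (Phi1 p);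
    iso_commutes_inv : forall q, Phi1 (Psi' q) = psi' (Phi2 q);
    iso_fst : forall z, Bimg Phi1 z -> psi z 0 0 = z 0 0
  }.

Section FiberedIso.
Context {R : realType}.

Lemma strictly_isomorphic_fibered (M1 M2 : symplectic4 R)
    (Phi1 : M1 -> 'rV[R]_2) (Phi2 : M2 -> 'rV[R]_2) :
  strictly_isomorphic Phi1 Phi2 ->
  exists Psi Psi' psi psi', fibered_iso Phi1 Phi2 Psi Psi' psi psi'.
Proof.
move=> [Psi [psi [[[sPsi [Psi' [sPsi' K K']]] sy] [[sp [psi' [sp' pK]]] im] fst c]]].
exists Psi, Psi', psi, psi'; split=> //; first by rewrite -im.
move=> q; rewrite -[q in RHS]K' c pK //; by exists (Psi' q).
Qed.

Context {M1 M2 : symplectic4 R} {Phi1 : M1 -> 'rV[R]_2} {Phi2 : M2 -> 'rV[R]_2}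
  {Psi : M1 -> M2} {Psi' : M2 -> M1} {psi psi' : 'rV[R]_2 -> 'rV[R]_2}
  (iso : fibered_iso Phi1 Phi2 Psi Psi' psi psi').

Lemma base_isoK z : Bimg Phi1 z -> psi' (psi z) = z.
Proof.
by move=> [p _ <-]; rewrite -(iso_commutes iso) -(iso_commutes_inv iso) (isoK iso).
Qed.

Lemma base_isoVK z : Bimg Phi2 z -> psi (psi' z) = z.
Proof.
by move=> [p _ <-]; rewrite -(iso_commutes_inv iso) -(iso_commutes iso) (isoVK iso).
Qed.

Lemma base_iso_img z : Bimg Phi1 z -> Bimg Phi2 (psi z).
Proof. by move=> [p _ <-]; exists (Psi p) => //; exact: iso_commutes iso p. Qed.

Lemma base_iso_img_inv z : Bimg Phi2 z -> Bimg Phi1 (psi' z).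
Proof. by move=> [p _ <-]; exists (Psi' p) => //; exact: iso_commutes_inv iso p. Qed.

Lemma fibered_iso_sym : fibered_iso Phi2 Phi1 Psi' Psi psi' psi.
Proof.
case: iso => s1 s2 K K' sy b1 b2 c1 c2 f; split=> //.
  exact: symplectic_map_inv sy.
move=> z Bz; rewrite -[in RHS](base_isoVK Bz) f //.
exact: base_iso_img_inv.
Qed.

End FiberedIso.

(** * Hamiltonian vector fields at points of rank zero *)

Section Singularities.
Context {R : realType}.

Lemma smooth_to_rep (M : manifold4 R) (V : normedModType R) (F : M -> V) i :
  smooth_to setT F -> smooth_open (chart i @` dom i) (F \o param i).
Proof. by move=> /(_ i); rewrite setIT. Qed.

Lemma near_eq_continuous (T S : topologicalType) (f g : T -> S) x :
  (\near x, f x = g x) -> {for x, continuous f} -> {for x, continuous g}.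
Proof.
move=> fg cf A; rewrite -(nbhs_singleton fg) => /cf.
by apply: filterS2 fg => y; rewrite /= => ->.
Qed.

Lemma smooth_to_continuous (M : manifold4 R) (V : normedModType R) (F : M -> V) :
  smooth_to setT F -> continuous F.
Proof.
move=> sF p; pose i := chart_at p; have dp : dom i p by exact: dom_chart_at.
have oi : nbhs p (dom i) by apply: open_nbhs_nbhs; split=> //; exact: dom_open.
have c1 : {for p, continuous ((F \o param i) \o chart i)}.
  apply: continuous_comp; first exact: chart_continuous.
  apply: (@smooth_open_continuous _ _ _ (chart i @` dom i)); last by exists p.
  exact: smooth_to_rep.
have E : {near p, (F \o param i) \o chart i =1 F}.
  by apply: filterS oi => q dq /=; rewrite chartK.
exact: near_eq_continuous E c1.
Qed.

(** This brings a Hamiltonian field into the form [a *m (D Phi)^T *m om^-1]: linear in [a], smooth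
    in the point, and zero where [D Phi] vanishes. *)
Lemma grad_pairing (M : symplectic4 R) (Phi : M -> 'rV[R]_2) a i x :
  differentiable (Phi \o param i) x ->
  grad (pairing a Phi \o param i) x = a *m (jacobian (Phi \o param i) x)^T.
Proof.
move=> dPhi; apply/rowP => b; rewrite !mxE.
have -> : pairing a Phi \o param i =
    \sum_(l < 2) (a 0 l *: (fun x => (Phi \o param i) x 0 l)).
  by apply/funext => y; rewrite fct_sumE.
rewrite derive_sum; last first.
  by move=> l; apply: derivableZ; exact: derivable_coord.
apply: eq_bigr => l _; rewrite deriveZ; last exact: derivable_coord.
by rewrite -derive_coord // -jacobianE // [in RHS]mxE.
Qed.

Lemma pairing_delta (M : symplectic4 R) (Phi : M -> 'rV[R]_2) l :
  pairing (delta_mx 0 l) Phi = fun p => Phi p 0 l.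
Proof.
apply/funext => p; rewrite /pairing (bigD1 l) //= big1 ?addr0.
  by rewrite mxE !eqxx mul1r.
by move=> k kl; rewrite mxE eqxx (negbTE kl) mul0r.
Qed.

Section RankZero.
Context {M : symplectic4 R} {Phi : M -> 'rV[R]_2} (sPhi : smooth_to setT Phi) (p : M).
Hypothesis rk0 : rk Phi p = 0%N.

Lemma rk0_jacobian :
  jacobian (Phi \o param (chart_at p)) (chart (chart_at p) p) = 0.
Proof. by apply/eqP; rewrite -mxrank_eq0; apply/eqP. Qed.

Lemma rk0_hamvec a : hamvec_at (pairing a Phi) p = 0.
Proof.
rewrite /hamvec_at /hamvec grad_pairing ?rk0_jacobian ?trmx0 ?mulmx0 ?mul0mx //.
apply: (smooth_open_differentiable (smooth_to_rep (chart_at p) sPhi)).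
by exists p => //; exact: dom_chart_at.
Qed.

(** At a point of rank 0 the condition in [slice_algebra], a congruence modulo the tangent space of
    the orbit, thus becomes an equality. *)
Lemma rk0_orbit_tangent : orbit_tangent Phi p = 0.
Proof.
rewrite /orbit_tangent /fstJ /sndH -!pairing_delta !rk0_hamvec.
exact: col_mx0.
Qed.

End RankZero.

Lemma smooth_hamvec (M : symplectic4 R) (Phi : M -> 'rV[R]_2) a i :
  smooth_to setT Phi -> smooth_open (chart i @` dom i) (hamvec (pairing a Phi) i).
Proof.
move=> sPhi; have oD := @image_open _ M i.
have sP := smooth_to_rep i sPhi.
have S : smooth_open (chart i @` dom i)
    (fun x => a *m (jacobian (Phi \o param i) x)^T *m invmx (om i x)).
  apply: smooth_mulmx => //.
    apply: smooth_mulmx => //; first exact: smooth_cst.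
    by apply: smooth_trmx => //; exact: smooth_jacobian_mx.
  apply: smooth_invmx => //; first exact: om_nondegenerate.
  by move=> k l; exact: om_smooth.
apply: smooth_eq S => // x /[!inE] Dx; rewrite /hamvec grad_pairing //.
exact: smooth_open_differentiable sP Dx.
Qed.

End Singularities.

(** * Invariance of focus-focus points *)

Section FocusFocus.
Context {R : realType}.

Lemma mxrank_unitl m n (T : 'M[R]_m) (A : 'M[R]_(m, n)) :
  T \in unitmx -> \rank (T *m A) = \rank A.
Proof. by move=> Tu; rewrite (eqmxMfull A) ?row_full_unit. Qed.

Lemma extends_near_shift (V W : normedModType R) (A : set V) (f : V -> W) x y U g :
  extends_near A f x U g -> U y -> extends_near A f y U g.
Proof. by case. Qed.

(** The middle factor will be the transposed differential of [Phi] at a point of rank 0; [C] carries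
    the change of coordinates on the base, [E] the symplectic form and the change of charts. *)
Lemma derive_mulmx_zero (V : normedModType R) m n p q (C : V -> 'M[R]_(m, n))
    (B : V -> 'M[R]_(n, p)) (E : V -> 'M[R]_(p, q)) (U : set V) x v :
  open U -> U x -> smooth_open U C -> smooth_open U B -> smooth_open U E -> B x = 0 ->
  'D_v (fun y => C y *m B y *m E y) x = C x *m 'D_v B x *m E x.
Proof.
move=> oU Ux sC sB sE B0.
have sCB := smooth_mulmx oU sC sB.
have d (W : normedModType R) (f : V -> W) (s : smooth_open U f) : differentiable f x.
  exact: smooth_open_differentiable s Ux.
rewrite derive_mulmx; [|exact: d|exact: d|exact/d/smooth_mulmx].
rewrite derive_mulmx; [|exact: d|exact: d|exact: d].
by rewrite B0 !mulmx0 mul0mx addr0 add0r.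
Qed.

Context {M1 M2 : symplectic4 R} {Phi1 : M1 -> 'rV[R]_2} {Phi2 : M2 -> 'rV[R]_2}
  {Psi : M1 -> M2} {Psi' : M2 -> M1} {psi psi' : 'rV[R]_2 -> 'rV[R]_2}
  (iso : fibered_iso Phi1 Phi2 Psi Psi' psi psi')
  (sPhi1 : smooth_to setT Phi1) (sPhi2 : smooth_to setT Phi2).

(** The part of chart [i] on which both sides of [Phi2 \o Psi = g \o Phi1] can be written in
    coordinates, [g] being a smooth extension of [psi] on [U]. *)
Definition adapted_dom i j (U : set 'rV[R]_2) : set 'rV[R]_4 :=
  chart i @` (dom i `&` (Psi @^-1` dom j `&` Phi1 @^-1` U)).

Lemma open_adapted_dom i j U : open U -> open (adapted_dom i j U).
Proof.
move=> oU; apply: open_chart_image; apply: openI.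
  exact: open_dom_preimage (iso_smooth iso).
by have /continuousP := smooth_to_continuous sPhi1; apply.
Qed.

(** This differentiates the commutative square. The extension [g] replaces [psi], which need not be
    differentiable, because the image of [Phi1] need not be open. *)
Lemma jacobian_commutes i j p U g :
  extends_near (Bimg Phi1) psi (Phi1 p) U g -> dom i p -> dom j (Psi p) ->
  jacobian (local_rep Psi i j) (chart i p) *m
    jacobian (Phi2 \o param j) (chart j (Psi p)) =
  jacobian (Phi1 \o param i) (chart i p) *m jacobian g (Phi1 p).
Proof.
move=> [oU Up sg eg] dp dq.
have dt := local_rep_differentiable (iso_smooth iso) dp dq.
have d1 : differentiable (Phi1 \o param i) (chart i p).
  by apply: (smooth_open_differentiable (smooth_to_rep i sPhi1)); exists p.
have d2 : differentiable (Phi2 \o param j) (chart j (Psi p)).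
  by apply: (smooth_open_differentiable (smooth_to_rep j sPhi2)); exists (Psi p).
have dg : differentiable g (Phi1 p) by exact: smooth_open_differentiable sg Up.
have E1 : (Phi1 \o param i) (chart i p) = Phi1 p by rewrite /= chartK.
rewrite -(local_repE Psi j dp) in d2 *; rewrite -E1 in dg *.
apply: etrans (esym (jacobian_comp dt d2)) _; apply: etrans _ (jacobian_comp d1 dg).
apply: (@open_eq_jacobian _ _ _ (adapted_dom i j U)).
- exact: open_adapted_dom.
- by exists p.
- move=> _ [q [dq1 [dq2 Uq]] <-]; rewrite /local_rep /= !chartK //.
  by rewrite (iso_commutes iso) eg //; split=> //; exists q.
- exact: differentiable_comp.
Qed.

(** Up to the invertible differential of [Psi], [D Phi2] is [D Phi1] times the differential of an
    extension of [psi]. *)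
Lemma rk_iso_le p : (rk Phi2 (Psi p) <= rk Phi1 p)%N.
Proof.
have [U [g eg]] := iso_base_smooth iso (ex_intro2 _ _ p I erefl : Bimg Phi1 (Phi1 p)).
have dp := dom_chart_at p; have dq := dom_chart_at (Psi p).
have := jacobian_commutes eg dp dq.
have Tu := jacobian_symplectic_unit (iso_symplectic iso) dp dq.
rewrite /rk => /(congr1 (@mxrank _ _ _)) H.
apply: leq_trans (mxrankM_maxl _ (jacobian g (Phi1 p))).
by rewrite -H mxrank_unitl.
Qed.

(* All terms of the product rule but one vanish because d Phi is zero at p. *)
Lemma linearization_natural p U g a : extends_near (Bimg Phi1) psi (Phi1 p) U g ->
  rk Phi1 p = 0%N ->
  let T := jacobian (local_rep Psi (chart_at p) (chart_at (Psi p)))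
             (chart (chart_at p) p) in
  T *m linearization Phi2 (Psi p) a =
  linearization Phi1 p (a *m (jacobian g (Phi1 p))^T) *m T.
Proof.
move=> eg rk0; have [oU Up sg _] := eg.
set i := chart_at p; set j := chart_at (Psi p); set x := chart i p.
have dp : dom i p := dom_chart_at p.
have dq : dom j (Psi p) := dom_chart_at (Psi p).
move=> T.
pose tau := local_rep Psi i j; pose D := adapted_dom i j U.
have oD : open D by exact: open_adapted_dom.
have Dx : D x by exists p.
have D1 : D `<=` chart i @` dom i by move=> _ [q [? _] <-]; exists q.
have D2 : D `<=` rep_dom Psi i j by move=> _ [q [? [? _]] <-]; exists q.
have s1 : smooth_open D (Phi1 \o param i) := smooth_sub D1 (smooth_to_rep i sPhi1).
have sJ1 : smooth_open D (fun y => (jacobian (Phi1 \o param i) y)^T).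
  by apply: smooth_trmx => //; exact: smooth_jacobian_mx.
have st : smooth_open D tau := smooth_sub D2 (smooth_map_rep i j (iso_smooth iso)).
have sT := smooth_jacobian_mx oD st.
have sOm : smooth_open D (fun y => invmx (om i y)).
  apply: smooth_invmx => // [y /D1|k l]; first exact: om_nondegenerate.
  exact: smooth_sub D1 (om_smooth i k l).
have sg' : smooth_open D (jacobian g \o (Phi1 \o param i)).
  apply: (smooth_comp_rV oD oU _ s1); last exact: smooth_jacobian_mx.
  by move=> _ [q [dq1 [_ Uq]] <-]; rewrite /= chartK.
have sA : smooth_open D (fun y => a *m (jacobian g (Phi1 (param i y)))^T).
  by apply: smooth_mulmx => //; [exact: smooth_cst | exact: smooth_trmx].
have B0 : (jacobian (Phi1 \o param i) x)^T = 0.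
  by rewrite (rk0_jacobian rk0) trmx0.
(* The field of [a . Phi2] along [tau], rewritten through [Phi1] and the form of [M1] so that the
   factor vanishing at [x] stands in the middle. Its derivative at [x] is computed by the chain rule
   in [L] and by the product rule in [L2]. *)
pose h y := a *m (jacobian g (Phi1 (param i y)))^T
  *m (jacobian (Phi1 \o param i) y)^T *m (invmx (om i y) *m jacobian tau y).
have hE y : D y -> h y = hamvec (pairing a Phi2) j (tau y).
  move=> [q [dq1 [dq2 Uq]] <-].
  rewrite /h /tau local_repE // chartK // /hamvec grad_pairing; last first.
    by apply: (smooth_open_differentiable (smooth_to_rep j sPhi2)); exists (Psi q).
  rewrite -[a *m _ *m _]mulmxA -trmx_mul.
  rewrite -(jacobian_commutes (extends_near_shift eg Uq) dq1 dq2).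
  have Tu := jacobian_symplectic_unit (iso_symplectic iso) dq1 dq2.
  have omu : om j (chart j (Psi q)) \in unitmx.
    by apply: om_nondegenerate; exists (Psi q).
  rewrite (iso_symplectic iso dq1 dq2) /=.
  move: (jacobian (local_rep _ _ _) _) Tu => S Su.
  rewrite !invmx_mul ?unitmx_mul ?unitmx_tr ?Su ?omu // trmx_mul.
  rewrite -!mulmxA mulVmx // mulmx1; congr (_ *m (_ *m _)).
  by rewrite mulmxA mulmxV ?unitmx_tr // mul1mx.
have nD (W : normedModType R) (f f' : 'rV[R]_4 -> W) v :
    (forall y, D y -> f y = f' y) -> 'D_v f x = 'D_v f' x.
  move=> ff; apply: near_eq_derive.
  by apply: filterS (open_nbhs_nbhs (conj oD Dx)) => y /ff.
have dH1 : differentiable (hamvec (pairing (a *m (jacobian g (Phi1 p))^T) Phi1) i) x.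
  by apply: (smooth_open_differentiable (smooth_hamvec _ i sPhi1)); exists p.
have dH2 : differentiable (hamvec (pairing a Phi2) j) (tau x).
  rewrite /tau local_repE //.
  by apply: (smooth_open_differentiable (smooth_hamvec _ j sPhi2)); exists (Psi p).
have dtau : differentiable tau x := smooth_open_differentiable st Dx.
apply/row_matrixP => k; rewrite [LHS]rowE [RHS]rowE; set v := delta_mx 0 k.
have L : 'D_v h x = v *m (T *m linearization Phi2 (Psi p) a).
  rewrite (nD _ _ _ v hE) (deriveEjacobian (f := hamvec _ j \o tau)); last first.
    exact: differentiable_comp.
  have E2 : jacobian (hamvec (pairing a Phi2) j) (tau x) =
      linearization Phi2 (Psi p) a by rewrite /tau (local_repE Psi j dp).
  apply: etrans (congr1 (mulmx v) (jacobian_comp dtau dH2)) _.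
  by rewrite E2.
pose a1 := a *m (jacobian g (Phi1 p))^T.
have L1 : v *m linearization Phi1 p a1 =
    a1 *m 'D_v (fun y => (jacobian (Phi1 \o param i) y)^T) x *m invmx (om i x).
  apply: etrans (esym (deriveEjacobian v dH1)) _.
  apply: etrans _ (derive_mulmx_zero v oD Dx (smooth_cst D a1) sJ1 sOm B0).
  apply: nD => y Dy; rewrite /hamvec grad_pairing //.
  exact: smooth_open_differentiable s1 Dy.
have L2 := derive_mulmx_zero v oD Dx sA sJ1 (smooth_mulmx oD sOm sT) B0.
have E : a *m (jacobian g (Phi1 (param i x)))^T = a1 by rewrite /a1 /x (chartK dp).
apply: etrans (esym L) _; apply: etrans L2 _.
apply: etrans (congr1 (fun w => w *m _ *m _) E) _; apply: etrans (mulmxA _ _ _) _.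
apply: etrans (congr1 (mulmx^~ _) (esym L1)) _; exact: esym (mulmxA v _ T).
Qed.

(** The frame is transported by [T]. The element of the image algebra given by [a] is the element of
    the original one given by [a] times the transposed differential of an extension of [psi]. The
    reverse inclusion will come from the inverse isomorphism. *)
Lemma focus_focus_natural_frame p (e : 'M[R]_(2 + 2, 4)) :
  symplectic_frame Phi1 p e ->
  let T := jacobian (local_rep Psi (chart_at p) (chart_at (Psi p)))
             (chart (chart_at p) p) in
  symplectic_frame Phi2 (Psi p) (e *m T) /\
  slice_algebra Phi2 (Psi p) (e *m T) `<=` slice_algebra Phi1 p e.
Proof.
move=> [rkp _ fe] T.
have dp := dom_chart_at p; have dq := dom_chart_at (Psi p).
have Tu : T \in unitmx := jacobian_symplectic_unit (iso_symplectic iso) dp dq.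
have rk0 : rk Phi1 p = 0%N by move: rkp; rewrite addn2 => -[].
have rk0' : rk Phi2 (Psi p) = 0%N.
  by apply/eqP; rewrite -leqn0 -rk0; exact: rk_iso_le.
split.
  split; first by rewrite rk0'.
    by rewrite rk0_orbit_tangent // trmx0 mulmx0.
  rewrite -fe /om_at (iso_symplectic iso dp dq) /= -/T.
  by rewrite trmx_mul !mulmxA.
move=> B [a [_]]; rewrite (rk0_orbit_tangent sPhi2) // => /submx0null/subr0_eq H.
have [U [g eg]] := iso_base_smooth iso (ex_intro2 _ _ p I erefl : Bimg Phi1 (Phi1 p)).
exists (a *m (jacobian g (Phi1 p))^T); split; first exact: rk0_hamvec.
suff -> : e *m linearization Phi1 p (a *m (jacobian g (Phi1 p))^T) = B *m e.
  by rewrite subrr; exact: sub0mx.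
have := linearization_natural a eg rk0; rewrite -/T => L.
have : e *m linearization Phi1 p (a *m (jacobian g (Phi1 p))^T) *m T = B *m e *m T.
  by rewrite -mulmxA -L mulmxA H mulmxA.
exact: (can_inj (mulmxK Tu)).
Qed.

End FocusFocus.

(** (F2) for the second system supplies compactness of the orbit and non-degeneracy, so only
    singularity and the normal form are transported. *)
Lemma focus_focus_natural (R : realType) (M1 M2 : symplectic4 R)
    (Phi1 : M1 -> 'rV[R]_2) (Phi2 : M2 -> 'rV[R]_2) Psi Psi' psi psi' p :
  fibered_iso Phi1 Phi2 Psi Psi' psi psi' ->
  smooth_to setT Phi1 -> smooth_to setT Phi2 ->
  (forall p, singular Phi2 p -> almost_toric Phi2 p) ->
  focus_focus Phi1 p -> focus_focus Phi2 (Psi p).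
Proof.
move=> iso s1 s2 at2 [[sing _ _ _] [e [fe se]]].
have [fe' sub] := focus_focus_natural_frame iso s1 s2 fe.
split; first by apply: at2; exact: leq_ltn_trans (rk_iso_le iso s1 s2 p) sing.
eexists; split; first exact: fe'.
rewrite -se; apply/seteqP; split=> //.
(* Transporting the frame forth and back gives [e] again, which yields the reverse inclusion. *)
have [_] := focus_focus_natural_frame (fibered_iso_sym iso) s2 s1 fe'.
rewrite (isoK iso) -mulmxA jacobian_local_rep_inv ?mulmx1 //.
- exact: iso_smooth iso.
- exact: iso_smooth_inv iso.
- exact: isoK iso.
- exact: dom_chart_at.
- exact: dom_chart_at.
Qed.

(** * Focus-focus values are discrete *)

Section ZeroVelocity.
Context {R : realType}.

Lemma is_derive_coord n (h : R -> 'rV[R]_n) (t : R) v k :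
  is_derive (t : R^o) (1 : R^o) (h : R^o -> _) v ->
  is_derive (t : R) (1 : R) (fun s => h s 0 k) (v 0 k).
Proof.
move=> [/derivable1_diffP dh <-]; apply: DeriveDef.
  exact: (derivable_coord (V := R^o) dh).
by rewrite (derive_coord (V := R^o) 1 0 k dh).
Qed.

Lemma zero_derive_cst_ball n (h : R -> 'rV[R]_n) (t0 e : R) :
  (forall t, ball t0 e t -> is_derive (t : R^o) (1 : R^o) (h : R^o -> _) 0) ->
  forall t, ball t0 e t -> h t = h t0.
Proof.
move=> dh.
have H k a b : a <= b -> ball t0 e a -> ball t0 e b -> h b 0 k = h a 0 k.
  move=> ab Ba Bb.
  have sub t : t \in `[a, b] -> ball t0 e t.
    rewrite in_itv /= => /andP[at_ tb]; move: Ba Bb.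
    by rewrite /ball /= !ltr_norml => /andP[? ?] /andP[? ?]; apply/andP; split; lra.
  have dk t : t \in `[a, b] -> is_derive t 1 (fun s => h s 0 k) 0.
    by move=> /sub/dh/(is_derive_coord k); rewrite mxE.
  pose f : R -> R := fun s => h s 0 k.
  have H1 (t : R) : t \in `]a, b[ -> is_derive t 1 f 0.
    by move=> /subset_itv_oo_cc/dk.
  have H2 : {within `[a, b], continuous f}.
    by apply: derivable_within_continuous => t /dk [].
  have [c _] := MVT_segment ab H1 H2.
  by rewrite mul0r => /eqP; rewrite subr_eq0 => /eqP.
move=> t Bt.
have e0 : 0 < e by move: Bt; rewrite /ball /=; apply: le_lt_trans.
have B0 : ball t0 e t0 by exact: ballxx.
apply/rowP => k; have [le|/ltW le] := leP t0 t; first exact: H.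
by symmetry; exact: H.
Qed.

Lemma connected_real : connected [set: R].
Proof. by apply/connected_intervalP => x y _ _ z. Qed.

(** The times at which the curve is at [gamma 0] form a closed set, as the manifold is Hausdorff,
    and an open one, as a chart expression with zero derivative is locally constant. The line is
    connected. *)
Lemma zero_velocity_constant (M : manifold4 R) (gamma : R -> M) :
  continuous gamma ->
  (forall t i, dom i (gamma t) ->
     is_derive (t : R^o) (1 : R^o) (fun s : R^o => chart i (gamma s)) 0) ->
  forall t, gamma t = gamma 0.
Proof.
move=> cg dg; pose A := [set t | gamma t = gamma 0].
suff AT : A = setT by move=> t; have : setT t by []; rewrite -AT.
have cA : closed A.
  have -> : A = gamma @^-1` [set gamma 0] by [].
  have cs : closed [set gamma 0].
    by apply: (@accessible_closed_set1 M); exact/hausdorff_accessible/mfd_hausdorff.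
  by move: cs; apply: (@closed_comp R M gamma) => t _; exact: cg.
have oA : open A.
  rewrite openE => t At; pose i := chart_at (gamma t).
  have /nbhs_ballP[e /= e0 be] : nbhs t (gamma @^-1` dom i).
    apply: cg; apply: open_nbhs_nbhs; split; first exact: dom_open.
    exact: dom_chart_at.
  apply/nbhs_ballP; exists e => //= s Bs.
  rewrite /A /= -At -(chartK (be s Bs)) -[RHS](chartK (be t (ballxx _ e0))).
  congr (param i _).
  by apply: (zero_derive_cst_ball (h := chart i \o gamma)) Bs => u /be; exact: dg.
apply: connected_real; first by exists 0.
  by exists A => //; rewrite setTI.
by exists A => //; rewrite setTI.
Qed.
End ZeroVelocity.

(** * Fixed points of a torus action and zeros of its vector fields *)

Section FixedPoints.
Context {R : realType}.

Lemma is_derive_translate n (h : R -> 'rV[R]_n) (t : R) v :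
  is_derive (0 : R^o) (1 : R^o) (h : R^o -> _) v ->
  is_derive (t : R^o) (1 : R^o) (fun s : R^o => h (s - t)) v.
Proof.
move=> [/derivable1_diffP dh <-].
have ds : is_diff (t : R^o) (fun s : R^o => s - t) id.
  have -> : (fun s : R^o => s - t) = id + cst (- t) by [].
  apply: is_diff_eq (is_diffD (is_diff_id _) (is_diff_cst _ _)) _.
  by apply/funext => s; rewrite !fctE addr0.
have dh' : differentiable (h : R^o -> _) ((fun s : R^o => s - t) t) by rewrite subrr.
have dc : differentiable ((h : R^o -> _) \o (fun s : R^o => s - t)) (t : R^o).
  exact: differentiable_comp.
apply: DeriveDef; first exact/derivable1_diffP.
apply: etrans (deriveE _ dc) _; rewrite diff_comp //= diff_val.
by rewrite (deriveE _ dh) subrr.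
Qed.

(* By the group law the velocity at time t is the image under the differential of
   rho (t *: a) of the velocity at time 0, hence zero; no uniqueness theorem for
   integral curves is needed. *)
Lemma zero_hamvec_fixed (M : symplectic4 R) k (rho : 'rV[R]_k -> M -> M)
    (mu : M -> 'rV[R]_k) a p :
  torus_action setT rho -> moment_map setT rho mu ->
  hamvec_at (pairing a mu) p = 0 -> forall t : R, rho (t *: a) p = p.
Proof.
move=> [_ r0 rD _ [_ srho]] [_ mm] h0 t.
have [cg dg] := mm a p I.
have E0 : rho (0 *: a) p = p by rewrite scale0r r0.
rewrite -[RHS]E0; move: t; apply: zero_velocity_constant => // t i dt.
pose i0 := chart_at p; pose x0 := chart i0 p.
have d0 : dom i0 p := dom_chart_at p.
pose F x := chart i (rho (t *: a) (param i0 x)).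
have dF : differentiable F x0.
  have E : F = (fun u : 'rV[R]_k * 'rV[R]_4 => chart i (rho u.1 (param i0 u.2))) \o
      (fun x => (t *: a, x)) by [].
  rewrite E; apply: differentiable_comp.
    by apply: differentiable_pair => //; exact: differentiable_cst.
  apply: smooth_open_differentiable (srho i0 i) _ => /=.
  by split; [exists p; rewrite ?setIT | rewrite chartK].
have dg0 : is_derive (0 : R^o) (1 : R^o) (fun s : R^o => chart i0 (rho (s *: a) p)) 0.
  by have := dg 0 i0; rewrite E0 => /(_ d0); rewrite -/(hamvec_at _ _) h0.
have dgt := is_derive_translate t dg0.
have := is_derive_local_rep (tau := F) dgt; rewrite subrr E0 mul0mx => /(_ dF).
apply: near_eq_is_derive.
have : \forall s \near 0, dom i0 (rho (s *: a) p).
  apply: cg; rewrite E0; apply: open_nbhs_nbhs; split=> //; exact: dom_open.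
rewrite (near_shift t 0); apply: filterS => s; rewrite /= sub0r => ds.
by rewrite /F chartK // -rD // -scalerDl addrC subrK.
Qed.

Lemma fixed_zero_hamvec (M : symplectic4 R) k (rho : 'rV[R]_k -> M -> M)
    (mu : M -> 'rV[R]_k) a p i :
  moment_map setT rho mu -> (forall t, rho t p = p) -> dom i p ->
  hamvec (pairing a mu) i (chart i p) = 0.
Proof.
move=> [_ mm] fx dp; have [_ /(_ 0 i)] := mm a p I.
rewrite fx => /(_ dp) [_ <-].
have -> : (fun s : R^o => chart i (rho (s *: a) p)) = cst (chart i p).
  by apply/funext => s; rewrite fx.
by rewrite derive_cst.
Qed.

(** With [A] the differential, a zero [y] makes [(y - x) A] small compared with [y - x], whereas
    invertibility of [A] bounds [y - x] by a multiple of [(y - x) A]. *)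
Lemma isolated_zero n (h : 'rV[R]_n -> 'rV[R]_n) x : differentiable h x ->
  h x = 0 -> jacobian h x \in unitmx -> \forall y \near x, h y = 0 -> y = x.
Proof.
move=> dh h0 Ju; pose A := jacobian h x.
have lA : linear (fun v : 'rV[R]_n => v *m invmx A).
  by move=> c u v; rewrite mulmxDl scalemxAl.
pose Al : {linear 'rV[R]_n -> 'rV[R]_n} := HB.pack (fun v : 'rV[R]_n => v *m invmx A)
  (GRing.isLinear.Build _ _ _ _ _ lA).
have cA : continuous Al.
  move=> v.
  apply: (@cvg_mulmx _ _ (nbhs v) _ _ _ id (cst (invmx A)) v (invmx A)).
    exact: cvg_id.
  exact: cvg_cst.
have [k k0 kP] := linear_lipschitz cA.
(* [k] is a Lipschitz constant of the inverse of [A]; this tolerance leads to [|v| <= |v| / 2],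
   hence to [v = 0]. *)
have [_ /eqaddoP/(_ (2 * k)^-1)] := (diff_locallyP _ _).1 dh.
rewrite invr_gt0 mulr_gt0 // => /(_ isT) Ho.
have : \forall v \near 0, `|(h \o shift x - (cst (h x) + 'd h x)) v| <= (2 * k)^-1 * `|v|.
  exact: Ho.
rewrite (near_shift x 0) /= sub0r; apply: filterS => y.
rewrite !fctE /= subrK h0 add0r => H hy; move: H; rewrite hy sub0r normrN.
set v := y - x => H.
have E : v = Al ('d h x v) by rewrite /= -(mul_rV_lin1 ('d h x)) mulmxK.
have : `|v| <= 2^-1 * `|v|.
  rewrite {1}E; apply: le_trans (kP _) _.
  rewrite -ler_pdivlMl //; apply: le_trans H _.
  by rewrite invfM mulrA [k^-1 * _]mulrC.
move=> lev; have v0 : `|v| <= 0 by lra.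
by apply/eqP; rewrite -subr_eq0 -normr_le0.
Qed.

End FixedPoints.

(** * The focus-focus subalgebra *)

Section FocusFocusForms.
Context {R : realType}.
Implicit Types (c : 'rV[R]_2) (B : 'M[R]_(2 + 2)) (v w : 'rV[R]_(2 + 2)).

Definition ff_quadratic c v : R := \sum_(l < 2) c 0 l * tnth (@foc_foc R) l v.

Definition ff_bilinear c v w : R :=
  c 0 0 * (xco 0 v * yco 1 w + xco 0 w * yco 1 v
           - xco 1 v * yco 0 w - xco 1 w * yco 0 v) +
  c 0 1 * (xco 0 v * yco 0 w + xco 0 w * yco 0 v
           + xco 1 v * yco 1 w + xco 1 w * yco 1 v).

Lemma ff_polarization c v w :
  ff_quadratic c (v + w) - ff_quadratic c v - ff_quadratic c w = ff_bilinear c v w.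
Proof.
rewrite /ff_quadratic /ff_bilinear !big_ord_recl !big_ord0 !(tnth_nth (fun=> 0)) /=.
have -> : lift ord0 ord0 = 1 :> 'I_2 by exact/val_inj.
rewrite /xco /yco !mxE.
ring.
Qed.

Lemma delta_bilinear n (i j : 'I_n) (v w : 'rV[R]_n) :
  (v *m delta_mx i j *m w^T) 0 0 = v 0 i * w 0 j.
Proof.
rewrite mxE (bigD1 j) //= big1 ?addr0; last first.
  move=> k kj; rewrite mxE big1 ?mul0r // => l _.
  by rewrite mxE (negbTE kj) andbF mulr0.
rewrite !mxE (bigD1 i) //= big1 ?addr0 ?mxE ?eqxx ?mulr1 //.
by move=> l li; rewrite mxE (negbTE li) mulr0.
Qed.

Lemma std_om_sq m : @std_om R m *m std_om m = - 1%:M.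
Proof.
rewrite /std_om mulmx_block !mul0mx !mulmx0 !mul1mx !mulmx1 !add0r !addr0.
by rewrite scalar_mx_block opp_block_mx oppr0.
Qed.

Lemma std_om_unit m : @std_om R m \in unitmx.
Proof.
apply: (mulmx1_unit (B := - std_om m) _).1.
by rewrite mulmxN std_om_sq opprK.
Qed.

Lemma bilinear_form_eq0 n (A : 'M[R]_n) :
  (forall v w : 'rV[R]_n, (v *m A *m w^T) 0 0 = 0) -> A = 0.
Proof.
move=> h; apply/matrixP => i j.
have := h (delta_mx 0 i) (delta_mx 0 j).
by rewrite -rowE trmx_delta -colE !mxE.
Qed.

Lemma ff_hamiltonian_exists c : exists B,
  hamiltonian_matrix (ff_quadratic c) B.
Proof.
pose E i j : 'M[R]_(2 + 2) := delta_mx i j.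
pose x k : 'I_(2 + 2) := lshift 2 k; pose y k : 'I_(2 + 2) := rshift 2 k.
(* The Gram matrix of the polarized form. Multiplying by the inverse of the symplectic matrix turns
   it into the linear Hamiltonian field. *)
pose S := c 0 0 *: (E (x 0) (y 1) + E (y 1) (x 0) - E (x 1) (y 0) - E (y 0) (x 1)) +
  c 0 1 *: (E (x 0) (y 0) + E (y 0) (x 0) + E (x 1) (y 1) + E (y 1) (x 1)).
exists (S *m invmx (std_om 2)) => v w.
rewrite mulmxA mulmxKV ?std_om_unit // ff_polarization.
pose ev A : R := (v *m A *m w^T) 0 0.
have evD A B : ev (A + B) = ev A + ev B by rewrite /ev mulmxDr mulmxDl mxE.
have evN A : ev (- A) = - ev A by rewrite /ev mulmxN mulNmx mxE.
have evZ a A : ev (a *: A) = a * ev A by rewrite /ev -scalemxAr -scalemxAl mxE.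
rewrite -/(ev S) /S !(evD, evN, evZ) /ev !delta_bilinear /ff_bilinear /xco /yco.
by rewrite !(mulrC (w _ _)).
Qed.

Lemma hamiltonian_formE c B : hamiltonian_matrix (ff_quadratic c) B ->
  forall v w, (v *m B *m std_om 2 *m w^T) 0 0 = ff_bilinear c v w.
Proof. by move=> h v w; rewrite h ff_polarization. Qed.

Lemma ff_bilinear0 v w : ff_bilinear 0 v w = 0.
Proof. by rewrite /ff_bilinear !mxE !mul0r addr0. Qed.

(** Pairing [v] with the four basis vectors gives one linear system for its [y]-coordinates and one
    for its [x]-coordinates. With [a], [b] the entries of [c], both have determinant
    [- (a ^+ 2 + b ^+ 2)], which over the reals vanishes only for [c = 0]. *)
Lemma ff_bilinear_degenerate c v : v != 0 -> (forall w, ff_bilinear c v w = 0) -> c = 0.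
Proof.
move=> v0 h.
pose x k : 'I_(2 + 2) := lshift 2 k; pose y k : 'I_(2 + 2) := rshift 2 k.
have E k l : (delta_mx 0 k : 'rV[R]_(2 + 2)) 0 l = (l == k)%:R by rewrite mxE eqxx.
have := h (delta_mx 0 (y 1)); have := h (delta_mx 0 (y 0)).
have := h (delta_mx 0 (x 1)); have := h (delta_mx 0 (x 0)).
rewrite /ff_bilinear /xco /yco !E /=.
rewrite !(mulr0, mul0r, mulr1, mul1r, addr0, add0r, subr0, sub0r).
move=> h1 h2 h3 h4.
set a := c 0 0 in h1 h2 h3 h4; set b := c 0 1 in h1 h2 h3 h4.
have solve u t : a * u + b * t = 0 -> a * - t + b * u = 0 ->
    a ^+ 2 + b ^+ 2 != 0 -> u = 0 /\ t = 0.
  move=> e1 e2 n0; split; apply: (mulfI n0); rewrite mulr0.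
    rewrite (_ : _ * _ = a * (a * u + b * t) + b * (a * - t + b * u)); last by ring.
    by rewrite e1 e2 !mulr0 addr0.
  rewrite (_ : _ * _ = b * (a * u + b * t) - a * (a * - t + b * u)); last by ring.
  by rewrite e1 e2 !mulr0 subr0.
have [s0|n0] := eqVneq (a ^+ 2 + b ^+ 2) 0.
  have /eqP := s0; rewrite paddr_eq0 ?sqr_ge0 // !sqrf_eq0 => /andP[/eqP a0 /eqP b0].
  apply/rowP => l; rewrite mxE; case: l => [[|[|//]] lt].
    by rewrite -[RHS]a0 /a; congr (c _ _); exact/val_inj.
  by rewrite -[RHS]b0 /b; congr (c _ _); exact/val_inj.
have [y1 y0] := solve _ _ h1 h2 n0; have [x0 x1] := solve _ _ h4 h3 n0.
case/negP: v0; apply/eqP/rowP => l; rewrite mxE.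
case: (splitP l) => k lk.
  have -> : l = lshift 2 k by exact/val_inj.
  case: k {lk} => [[|[|//]] lt]; [rewrite -[RHS]x0|rewrite -[RHS]x1];
  by congr (v _ (lshift _ _)); exact/val_inj.
have -> : l = rshift 2 k by exact/val_inj.
case: k {lk} => [[|[|//]] lt]; [rewrite -[RHS]y0|rewrite -[RHS]y1];
by congr (v _ (rshift _ _)); exact/val_inj.
Qed.

(** A row vector killed by [B] lies in the radical of the associated form, so the coefficients [c]
    vanish, and [B] with them. *)
Lemma ff_hamiltonian_unit c B : hamiltonian_matrix (ff_quadratic c) B ->
  B != 0 -> B \in unitmx.
Proof.
move=> hB; apply: contraNT => Bu; apply/eqP.
have [v v0 vB] : exists2 v : 'rV[R]_(2 + 2), v != 0 & v *m B = 0.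
  exists (nz_row (kermx B)).
    by rewrite nz_row_eq0 kermx_eq0 row_free_unit.
  by apply/sub_kermxP; exact: nz_row_sub.
have c0 : c = 0.
  apply: (ff_bilinear_degenerate v0) => w.
  by rewrite -(hamiltonian_formE hB) vB !mul0mx mxE.
have : B *m std_om 2 = 0.
  apply: bilinear_form_eq0 => u w; rewrite mulmxA (hamiltonian_formE hB) c0.
  exact: ff_bilinear0.
by move/(congr1 (mulmx^~ (invmx (std_om 2)))); rewrite /= mulmxK ?std_om_unit // mul0mx.
Qed.

(* If the linearization of J vanished, the slice algebra would be spanned by that
   of H alone. *)
Lemma ff_span_not_line B0 : ~ (forall B, quadratic_span (@foc_foc R) B ->
  exists a, B = a *: B0).
Proof.
move=> h.
(* Pairing [x] with [y 0] and [y 1] gives the values 0, 1 for the first generator and 1, 0 for the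
   second; these cannot both be multiples of one pair. *)
pose x : 'rV[R]_(2 + 2) := delta_mx 0 (lshift 2 0).
pose y k : 'rV[R]_(2 + 2) := delta_mx 0 (rshift 2 k).
have F c : exists a, forall k, ff_bilinear c x (y k) = a * (x *m B0 *m std_om 2 *m (y k)^T) 0 0.
  have [B hB] := ff_hamiltonian_exists c.
  have [a Ba] := h B (ex_intro _ c hB); exists a => k.
  by rewrite -(hamiltonian_formE hB) Ba -scalemxAr -!scalemxAl mxE.
have [a Fa] := F (delta_mx 0 0); have [b Fb] := F (delta_mx 0 1).
have := Fa 0; have := Fa 1; have := Fb 0.
rewrite /ff_bilinear /xco /yco !mxE /=.
rewrite !(mulr0, mul0r, mulr1, mul1r, addr0, add0r, subr0, sub0r, oppr0).
move=> e3 e2 e1.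
have a0 : a != 0 by apply/eqP => a0; move: e2; rewrite a0 mul0r => /eqP; rewrite oner_eq0.
move: e1 => /esym/eqP; rewrite mulf_eq0 (negbTE a0) /= => /eqP e1.
by move: e3; rewrite e1 mulr0 => /eqP; rewrite oner_eq0.
Qed.

End FocusFocusForms.

(** * The linearization of the field of J at a focus-focus point *)

Section FocusFocusIsolated.
Context {R : realType} {M : symplectic4 R} {Phi : M -> 'rV[R]_2}
  (sPhi : smooth_to setT Phi).

Lemma row2_delta (a : 'rV[R]_2) :
  a = a 0 0 *: delta_mx 0 0 + a 0 1 *: delta_mx 0 1.
Proof.
rewrite [LHS]row_sum_delta !big_ord_recl big_ord0 addr0.
by have -> : lift ord0 ord0 = 1 :> 'I_2 by exact/val_inj.
Qed.

Lemma mulmx_ext m n (A B : 'M[R]_(m, n)) :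
  (forall v : 'rV[R]_m, v *m A = v *m B) -> A = B.
Proof. by move=> h; apply/row_matrixP => i; rewrite rowE h -rowE. Qed.

Lemma mulmx_ext_comb m n (A B C : 'M[R]_(m, n)) b c :
  (forall v : 'rV[R]_m, v *m A = b *: (v *m B) + c *: (v *m C)) -> A = b *: B + c *: C.
Proof. by move=> h; apply: mulmx_ext => v; rewrite mulmxDr -!scalemxAr. Qed.

Lemma linearization_linear p (a : 'rV[R]_2) : linearization Phi p a =
  a 0 0 *: linearization Phi p (delta_mx 0 0) +
  a 0 1 *: linearization Phi p (delta_mx 0 1).
Proof.
set i := chart_at p; set x := chart i p.
have dp : dom i p := dom_chart_at p.
have Dx : (chart i @` dom i) x by exists p.
pose f b := hamvec (pairing b Phi) i.
have df b : differentiable (f b) x.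
  exact: smooth_open_differentiable (smooth_hamvec b i sPhi) Dx.
have fE y : (chart i @` dom i) y ->
    f a y = (a 0 0 *: f (delta_mx 0 0) + a 0 1 *: f (delta_mx 0 1)) y.
  move=> Dy; rewrite !fctE /f /hamvec !grad_pairing; last 3 first.
  - exact: smooth_open_differentiable (smooth_to_rep i sPhi) Dy.
  - exact: smooth_open_differentiable (smooth_to_rep i sPhi) Dy.
  - exact: smooth_open_differentiable (smooth_to_rep i sPhi) Dy.
  by rewrite !scalemxAl -!mulmxDl -row2_delta.
apply: mulmx_ext_comb => v.
apply: etrans (esym (deriveEjacobian v (df a))) _.
apply: etrans _ (congr2 (fun u w => a 0 0 *: u + a 0 1 *: w)
  (deriveEjacobian v (df (delta_mx 0 0))) (deriveEjacobian v (df (delta_mx 0 1)))).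
have dZ b c : derivable (c *: f b) x v by apply/derivableZ/diff_derivable/df.
have E c b : c *: 'D_v (f b) x = 'D_v (c *: f b) x.
  by symmetry; apply: deriveZ; apply/diff_derivable/df.
apply: etrans _ (congr2 +%R (esym (E _ _)) (esym (E _ _))).
apply: etrans _ (deriveD (dZ _ _) (dZ _ _)).
apply: near_eq_derive.
by apply: filterS (open_nbhs_nbhs (conj (@image_open _ M i) Dx)) => y /fE.
Qed.

Lemma focus_focus_rk0 p : focus_focus Phi p -> rk Phi p = 0%N.
Proof. by move=> [_ [e [[rkp _ _] _]]]; move: rkp; rewrite addn2 => -[]. Qed.

(** In the frame [e] this linearization is an element of the focus-focus algebra, in which every
    nonzero element is invertible; that the algebra is more than a line excludes the value 0. *)
Lemma focus_focus_linearization_unit p : focus_focus Phi p ->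
  linearization Phi p (delta_mx 0 0) \in unitmx.
Proof.
move=> ff; have rk0 := focus_focus_rk0 ff; case: ff => _ [e [[_ _ fe] se]].
(* [2 + 2] computes to 4, so [e] can be read as a square matrix, and the frame identity makes it
   invertible. *)
have eu : (e : 'M[R]_4) \in unitmx.
  have := std_om_unit (R := R) 2; rewrite -fe => U.
  by move: (U : (e : 'M[R]_4) *m om_at p *m (e : 'M[R]_4)^T \in unitmx);
    rewrite !unitmx_mul => /andP[/andP[]].
pose e4 : 'M[R]_4 := e; pose ei := invmx e4.
have K1 (X : 'M[R]_4) : X = X *m ei *m e4 by rewrite mulmxKV.
have K2 (X : 'M[R]_4) : e4 *m X *m ei = 0 -> X = 0.
  move/(congr1 (fun Y => ei *m Y *m e4)).
  by rewrite /= mulmx0 mul0mx -!mulmxA mulVmx // mulmx1 mulmxA mulVmx // mul1mx.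
have K3 a (X B : 'M[R]_4) : a *: (e4 *m X) = B *m e4 -> B = a *: (e4 *m X *m ei).
  by move=> H; rewrite scalemxAl H mulmxK.
pose L k := linearization Phi p (delta_mx 0 k).
have sliceE B : slice_algebra Phi p e B <-> exists a, e *m linearization Phi p a = B *m e.
  split=> [[a [_]]|[a aE]].
    by rewrite (rk0_orbit_tangent sPhi) // => /submx0null/subr0_eq H; exists a.
  exists a; split; first exact: rk0_hamvec.
  by rewrite aE subrr; exact: sub0mx.
have conj_slice a : slice_algebra Phi p e (e4 *m linearization Phi p a *m ei).
  by apply/sliceE; exists a; exact: K1.
have := conj_slice (delta_mx 0 0); rewrite se => -[c hB].
have [B0|Bn0] := eqVneq (e4 *m linearization Phi p (delta_mx 0 0) *m ei) 0.
  exfalso; apply: (@ff_span_not_line R (e4 *m L 1 *m ei)) => B.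
  rewrite -se => /sliceE [a]; rewrite linearization_linear (K2 _ B0).
  by rewrite scaler0 add0r -scalemxAr => aE; exists (a 0 1); exact: K3.
have U : e4 *m linearization Phi p (delta_mx 0 0) *m ei \in unitmx.
  exact: (ff_hamiltonian_unit hB Bn0).
by move: U; rewrite !unitmx_mul => /andP[/andP[]].
Qed.

End FocusFocusIsolated.

(** * Focus-focus values near a point of the base *)

Section FocusFocusValues.
Context {R : realType} {M : symplectic4 R} {Phi : M -> 'rV[R]_2}.
Hypothesis semitoric : faithful_semitoric Phi.

Lemma semitoric_smooth : smooth_to setT Phi.
Proof. by case: semitoric => -[]. Qed.

(** The moment map of the circle action takes values in rows of length 1; this matches its
    Hamiltonian with the first component of [Phi]. *)
Lemma pairing_fstJ : pairing (const_mx 1 : 'rV[R]_1)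
  (fun p => \row_(_ < 1) fstJ Phi p : 'rV[R]_1) = pairing (delta_mx 0 0) Phi.
Proof.
rewrite pairing_delta; apply/funext => p.
by rewrite /pairing big_ord_recl big_ord0 !mxE mul1r addr0.
Qed.

Lemma focus_focus_isolated rho p : torus_action setT rho ->
  moment_map setT rho (fun p => \row_(_ < 1) fstJ Phi p) -> focus_focus Phi p ->
  isolated [set p | forall t, rho t p = p] p.
Proof.
move=> ta mm ff; have sPhi := semitoric_smooth; have rk0 := focus_focus_rk0 ff.
pose i := chart_at p; have dp : dom i p := dom_chart_at p.
pose h := hamvec (pairing (delta_mx 0 0) Phi) i.
have h0 : h (chart i p) = 0 := rk0_hamvec sPhi rk0 _.
have fp t : rho t p = p.
  have -> : t = t 0 0 *: const_mx 1.
    by apply/rowP => k; rewrite !mxE mulr1 ord1.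
  by apply: (zero_hamvec_fixed ta mm); rewrite pairing_fstJ.
split; first by rewrite inE.
have dh : differentiable h (chart i p).
  by apply: (smooth_open_differentiable (smooth_hamvec _ i sPhi)); exists p.
have nz := isolated_zero dh h0 (focus_focus_linearization_unit sPhi ff).
exists [set q | dom i q /\ (h (chart i q) = 0 -> chart i q = chart i p)].
  apply: filterI; first by apply: open_nbhs_nbhs; split=> //; exact: dom_open.
  exact: (chart_continuous dp) nz.
apply/seteqP; split=> [q [[dq hq] fq]|_ ->] /=; last by [].
rewrite -(chartK dq) -[RHS](chartK dp); congr (param i _); apply: hq.
by have := fixed_zero_hamvec (const_mx 1) mm fq dq; rewrite pairing_fstJ.
Qed.

(** The first coordinate of a focus-focus value is a critical value of J, so by (F5) the values near
    [c] lie on its vertical line, where (F6) leaves finitely many, as they come from isolated fixed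
    points. Taking [c] anywhere in the base gives relative closedness and not only discreteness. *)
Lemma Bff_discrete c : Bimg Phi c -> \forall z \near c, Bff Phi z -> z = c.
Proof.
move=> [p _ pc].
case: semitoric => -[sPhi _ _ _] _ _ _ [rho [[ta _ mm] _ F5 F6]].
have [U Uc critU] : exists2 U, nbhs (c 0 0) U &
    forall x, U x -> critical_values_J Phi x -> x = c 0 0.
  have Jc : range (fstJ Phi) (c 0 0) by exists p => //; rewrite /fstJ pc.
  have /existsNP[U /not_implyP[Uc nU]] := F5 _ Jc; exists U => // x Ux cx.
  apply: contrapT => /eqP xc; apply: nU; exists x; split=> //.
pose T := Phi @` (fstJ Phi @^-1` [set c 0 0] `&`
  isolated [set p | forall t, rho t p = p]).
have Tfin : finite_set T by apply: finite_image; exact: F6.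
have TC : closed (T `\ c).
  have acc : accessible_space 'rV[R]_2 by exact/hausdorff_accessible/norm_hausdorff.
  by apply: (accessible_finite_set_closed.1 acc); exact: finite_setD.
have nT : nbhs c (~` (T `\ c)).
  by apply: open_nbhs_nbhs; split; [exact: closed_openC | move=> [_]; exact].
have nU : nbhs c [set z : 'rV[R]_2 | U (z 0 0)].
  exact: (@coord_continuous _ 1 2 0 0 c) Uc.
apply: filterS2 nT nU => z nTz Uz [q ff qz].
have Jq : fstJ Phi q = c 0 0.
  rewrite /fstJ qz; apply: critU => //; exists q; last by rewrite /fstJ qz.
  rewrite /= /fstJ -pairing_delta grad_pairing.
    by rewrite (rk0_jacobian (focus_focus_rk0 ff)) trmx0 mulmx0.
  apply: (smooth_open_differentiable (smooth_to_rep (chart_at q) sPhi)).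
  by exists q => //; exact: dom_chart_at.
apply: contrapT => zc; apply: nTz; split=> //; exists q => //; split=> //.
exact: (focus_focus_isolated ta mm ff).
Qed.

Lemma Bwt_near c : Bwt Phi c -> \forall z \near c, ~ Bff Phi z.
Proof.
move=> [Bc nff]; apply: filterS (Bff_discrete Bc) => z h Bz.
by apply: nff; rewrite -(h Bz).
Qed.

(** The set is open in the manifold even if the base is not open in the plane, since [Phi] only
    meets points of its image. *)
Lemma open_preimage_Bwt O : open O -> open (Phi @^-1` (O `&` Bwt Phi)).
Proof.
move=> oO; rewrite openE => p [Op wp].
have cPhi := smooth_to_continuous semitoric_smooth.
have near_c : \forall z \near Phi p, O z /\ ~ Bff Phi z.
  by apply: filterI (open_nbhs_nbhs (conj oO Op)) (Bwt_near wp).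
have np : nbhs p (Phi @^-1` [set z | O z /\ ~ Bff Phi z]) by exact: cPhi near_c.
by apply: filterS np => q [Oq nq]; split=> //; split=> //; exists q.
Qed.

End FocusFocusValues.

(** * Transport of affine charts *)

Section SmoothOn.
Context {R : realType}.
Implicit Types V W Z : normedModType R.

Lemma smooth_on_sub V W (A B : set V) (f : V -> W) : B `<=` A ->
  smooth_on A f -> smooth_on B f.
Proof.
move=> BA sf x /BA/sf[U [g [oU Ux sg eg]]]; exists U, g; split=> // z [Uz Bz].
by apply: eg; split=> //; exact: BA.
Qed.

Lemma extends_near_comp V Z n (A : set V) (B : set 'rV[R]_n) (f : V -> 'rV[R]_n)
    (g : 'rV[R]_n -> Z) x U f' (U' : set 'rV[R]_n) g' :
  (forall z, A z -> B (f z)) -> A x ->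
  extends_near A f x U f' -> extends_near B g (f x) U' g' ->
  extends_near A (g \o f) x (U `&` f' @^-1` U') (g' \o f').
Proof.
move=> fAB Ax [oU Ux sf ef] [oU' U'fx sg eg].
have oUU : open (U `&` f' @^-1` U').
  by apply: open_setI_preimage => // y; exact: smooth_open_continuous sf.
split=> //.
- by split=> //; rewrite /= ef.
- apply: (smooth_comp_rV oUU oU') => //; first by move=> y [].
  by apply: smooth_sub sf => y [].
- by move=> z [[Uz U'z] Az] /=; rewrite -ef // eg //; split=> //; rewrite ef //; exact: fAB.
Qed.

Lemma smooth_on_comp V Z n (A : set V) (B : set 'rV[R]_n) (f : V -> 'rV[R]_n)
    (g : 'rV[R]_n -> Z) : (forall z, A z -> B (f z)) ->
  smooth_on A f -> smooth_on B g -> smooth_on A (g \o f).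
Proof.
move=> fAB sf sg x Ax.
have [U [f' ef]] := sf x Ax; have [U' [g' eg]] := sg _ (fAB x Ax).
by eexists; eexists; exact: extends_near_comp fAB Ax ef eg.
Qed.

Lemma smooth_on_continuous V W (A : set V) (f : V -> W) : smooth_on A f ->
  {within A, continuous f}.
Proof.
move=> sf; apply/subspace_continuousP => x Ax.
have [U [g [oU Ux sg eg]]] := sf x Ax.
have cg := smooth_open_continuous sg Ux.
have E : f x = g x by rewrite eg.
move=> N Nf; have gN : nbhs x (g @^-1` N) by apply: cg; rewrite -E.
apply: filterS2 gN (open_nbhs_nbhs (conj oU Ux)) => z gz Uz Az.
by change (N (f z)); rewrite -eg.
Qed.

Lemma within_preimage_open (T S : topologicalType) (A : set T) (f : T -> S) (O : set S) :
  {within A, continuous f} -> open O ->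
  exists O', open O' /\ A `&` f @^-1` O = O' `&` A.
Proof.
move=> /subspace_continuousP cf oO; exists (interior [set y | A y -> O (f y)]).
split; first exact: open_interior.
apply/seteqP; split=> y [].
  move=> Ay Oy; split=> //.
  exact: (cf y Ay) (open_nbhs_nbhs (conj oO Oy)).
by move=> /interior_subset h Ay; split=> //; exact: h.
Qed.

End SmoothOn.

Lemma continuous_pair_snd (T S S' : topologicalType) (f : S -> S') t x :
  {for x, continuous f} -> {for (t, x), continuous (fun u : T * S => (u.1, f u.2))}.
Proof.
move=> cf.
have c2 : {for (t, x), continuous (fun u : T * S => f u.2)}.
  by apply: (@continuous_comp _ _ _ snd f); [exact: cvg_snd | exact: cf].
have c1 : {for (t, x), continuous (fst : T * S -> T)} by exact: cvg_fst.
exact: (cvg_pair c1 c2).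
Qed.

Section ChartTransport.
Context {R : realType} {M1 M2 : symplectic4 R} {Phi1 : M1 -> 'rV[R]_2} {Phi2 : M2 -> 'rV[R]_2}
  {Psi : M1 -> M2} {Psi' : M2 -> M1} {psi psi' : 'rV[R]_2 -> 'rV[R]_2}
  (iso : fibered_iso Phi1 Phi2 Psi Psi' psi psi').

Lemma smooth_to_comp (V : normedModType R) (W : set M1) (F : M1 -> V) :
  open W -> smooth_to W F -> smooth_to (Psi' @^-1` W) (F \o Psi').
Proof.
move=> oW sF i; have sPsi' := iso_smooth_inv iso.
have cPsi' : continuous Psi' by case: sPsi'.
apply: smooth_local => _ [q [dq Wq] <-].
pose j := chart_at (Psi' q); have dj : dom j (Psi' q) := dom_chart_at _.
pose D := chart i @` (dom i `&` (Psi' @^-1` (dom j `&` W))).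
have oDj : open (dom j `&` W) by apply: openI => //; exact: dom_open.
have oD : open D.
  by apply: open_chart_image; move/continuousP: cPsi'; apply.
exists D, ((F \o param j) \o local_rep Psi' i j); split=> //.
- by exists q.
- have oj : open (chart j @` (dom j `&` W)) := open_chart_image oW.
  apply: (@smooth_comp_rV _ _ _ _ D _ (local_rep Psi' i j) (F \o param j) oD oj) => //.
    move=> _ [r [dr [dr' Wr]] <-]; rewrite local_repE //; by exists (Psi' r).
  apply: smooth_sub (smooth_map_rep i j sPsi') => _ [r [dr [dr' Wr]] <-].
  by exists r.
- by move=> _ [r [dr [dr' Wr]] <-]; rewrite /local_rep /= !chartK.
Qed.

Lemma smooth_to_pairing (M : symplectic4 R) (W : set M) k (mu : M -> 'rV[R]_k) a :
  open W -> smooth_to W mu -> smooth_to W (pairing a mu).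
Proof.
move=> oW smu i; have oD : open (chart i @` (dom i `&` W)) := open_chart_image oW.
have S l : smooth_open (chart i @` (dom i `&` W))
    (fun x => a 0 l * (mu \o param i) x 0 l).
  apply: (@smooth_mul _ _ _ (cst (a 0 l))) => //; first exact: (@smooth_cst _ _ R).
  exact: smooth_coord.
exact: (smooth_sum _ oD S).
Qed.

Lemma open_action_dom k (W : set M1) (rho : 'rV[R]_k -> M1 -> M1) (i j : idx M1) :
  open W -> torus_action W rho ->
  open [set u : 'rV[R]_k * 'rV[R]_4 | (chart i @` (dom i `&` W)) u.2 /\
                                     dom j (rho u.1 (param i u.2))].
Proof.
move=> oW [_ _ _ _ [crho _]].
pose A : set ('rV[R]_k * 'rV[R]_4) := snd @^-1` (chart i @` (dom i `&` W)).
have oA : open A.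
  by apply: open_comp (open_chart_image oW) => u _; exact: cvg_snd.
have := open_setI_preimage oA _ (@dom_open _ M1 j)
  (f := fun u : 'rV[R]_k * 'rV[R]_4 => rho u.1 (param i u.2)).
apply => -[t x] [p [dp Wp] /= px].
apply: (@continuous_comp _ _ _ (fun u : 'rV[R]_k * 'rV[R]_4 => (u.1, param i u.2))
  (fun u : 'rV[R]_k * M1 => rho u.1 u.2)).
  by apply: continuous_pair_snd; apply: param_continuous; exists p.
by apply: crho; rewrite /= -px chartK.
Qed.

Definition transported_action k (rho : 'rV[R]_k -> M1 -> M1) t q := Psi (rho t (Psi' q)).

Lemma torus_action_transport k (W : set M1) (rho : 'rV[R]_k -> M1 -> M1) :
  open W -> torus_action W rho ->
  torus_action (Psi' @^-1` W) (transported_action rho).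
Proof.
move=> oW ta; have [r1 r2 r3 r4 [r5 r6]] := ta.
have sPsi := iso_smooth iso; have sPsi' := iso_smooth_inv iso.
have cPsi : continuous Psi by case: sPsi.
have cPsi' : continuous Psi' by case: sPsi'.
rewrite /transported_action; split.
- by move=> t q Wq; rewrite /= (isoK iso); exact: r1.
- by move=> q Wq; rewrite r2 // (isoVK iso).
- by move=> s t q Wq; rewrite r3 // (isoK iso).
- by move=> t q Wq lt; rewrite r4 // (isoVK iso).
split=> [t q Wq|i j].
  apply: (@continuous_comp _ _ _ (fun u => rho u.1 (Psi' u.2)) Psi); last exact: cPsi.
  apply: (@continuous_comp _ _ _ (fun u : 'rV[R]_k * M2 => (u.1, Psi' u.2))
    (fun u : 'rV[R]_k * M1 => rho u.1 u.2)); last exact: r5.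
  by apply: continuous_pair_snd; exact: cPsi'.
apply: smooth_local => -[t x] [[q [dq Wq] /= <-]]; rewrite chartK // => dj.
(* Locally the transported action is a composite of three coordinate maps: [A] applies [Psi'] to the
   point, [G] is the original action, and a representative of [Psi] follows. The intermediate charts
   are taken at the given point, and on [U3] all three maps are defined. *)
pose i' := chart_at (Psi' q); have di' : dom i' (Psi' q) := dom_chart_at _.
pose j' := chart_at (rho t (Psi' q)); have dj' : dom j' (rho t (Psi' q)) := dom_chart_at _.
pose S1 := [set u : 'rV[R]_k * 'rV[R]_4 | (chart i' @` (dom i' `&` W)) u.2 /\
                                     dom j' (rho u.1 (param i' u.2))].
have oS1 : open S1 by exact: open_action_dom.
pose D := chart i @` (dom i `&` (Psi' @^-1` (dom i' `&` W))).
have oD : open D.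
  apply: open_chart_image; move/continuousP: cPsi'; apply.
  by apply: openI => //; exact: dom_open.
pose U1 : set ('rV[R]_k * 'rV[R]_4) := snd @^-1` D.
have oU1 : open U1 by apply: open_comp oD => u _; exact: cvg_snd.
pose A (u : 'rV[R]_k * 'rV[R]_4) := (u.1, local_rep Psi' i i' u.2).
have sA : smooth_open U1 A.
  apply: smooth_pair => //.
    by apply: (smooth_lin (c := fstl _ _)) => // u; exact: cvg_fst.
  apply: (smooth_comp_rV (f := snd) oU1 oD) => //.
    by apply: (smooth_lin (c := sndl _ _)) => // u; exact: cvg_snd.
  by apply: smooth_sub (smooth_map_rep i i' sPsi') => _ [r [dr [dr' Wr]] <-]; exists r.
pose G (u : 'rV[R]_k * 'rV[R]_4) := chart j' (rho u.1 (param i' u.2)).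
pose U2 := U1 `&` A @^-1` S1.
have oU2 : open U2.
  by apply: open_setI_preimage => // u; exact: smooth_open_continuous sA.
have sGA : smooth_open U2 (G \o A).
  apply: (smooth_comp_pair oU2 oS1); first by move=> u [].
    by apply: smooth_sub sA => u [].
  exact: r6.
pose U3 := U2 `&` (G \o A) @^-1` rep_dom Psi j' j.
have cGA u : U2 u -> {for u, continuous (G \o A)}.
  exact: smooth_open_continuous sGA.
have oU3 : open U3 := open_setI_preimage oU2 cGA (open_rep_dom (i := j') (j := j) sPsi).
have DE r : dom i r -> dom i' (Psi' r) -> W (Psi' r) -> D (chart i r) by move=> *; exists r.
exists U3, (local_rep Psi j' j \o (G \o A)); split=> //.
- have AE : A (t, chart i q) = (t, chart i' (Psi' q)) by rewrite /A /= local_repE.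
  split; first split.
  + exact: DE.
  + rewrite /= AE; split=> /=; first by exists (Psi' q).
    by rewrite chartK.
  + rewrite /= AE /G /= chartK //; exact: rep_domE.
- apply: (smooth_comp_rV oU3 (open_rep_dom (i := j') (j := j) sPsi)); first by move=> u [].
    by apply: smooth_sub sGA => u [].
  exact: smooth_map_rep.
- move=> [s y] [[[r [dr [dr' Wr]] /= <-] [_ dd]] _].
  have AE : A (s, chart i r) = (s, chart i' (Psi' r)) by rewrite /A /= local_repE.
  move: dd; rewrite AE /= chartK // => dd.
  by rewrite local_repE //= /G /= !chartK.
Qed.

Lemma effective_transport k (W : set M1) (rho : 'rV[R]_k -> M1 -> M1) :
  effective W rho -> effective (Psi' @^-1` W) (transported_action rho).
Proof.
move=> eff t h; apply: eff => p Wp; apply: (can_inj (isoK iso)).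
have := h (Psi p); rewrite /transported_action /= (isoK iso); exact.
Qed.

Lemma moment_map_transport k (W : set M1) (rho : 'rV[R]_k -> M1 -> M1)
    (mu : M1 -> 'rV[R]_k) : open W -> torus_action W rho ->
  moment_map W rho mu ->
  moment_map (Psi' @^-1` W) (transported_action rho) (mu \o Psi').
Proof.
move=> oW [rW _ _ _ _] [smu mm]; have sPsi' := iso_smooth_inv iso.
have oW2 : open (Psi' @^-1` W) by case: sPsi' => /continuousP + _; apply.
split=> [|a q Wq]; first exact: smooth_to_comp.
have E : pairing a (mu \o Psi') \o Psi = pairing a mu.
  by apply/funext => p; rewrite /pairing /= (isoK iso).
apply: (integral_curve_natural (iso_smooth iso) (iso_symplectic iso) oW2).
- by apply: smooth_to_pairing => //; exact: smooth_to_comp.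
- by move=> t; rewrite /= (isoK iso); exact: rW.
- by rewrite E; exact: mm.
Qed.

End ChartTransport.

Section BaseMap.
Context {R : realType} {M1 M2 : symplectic4 R} {Phi1 : M1 -> 'rV[R]_2} {Phi2 : M2 -> 'rV[R]_2}
  {Psi : M1 -> M2} {Psi' : M2 -> M1} {psi psi' : 'rV[R]_2 -> 'rV[R]_2}
  (iso : fibered_iso Phi1 Phi2 Psi Psi' psi psi')
  (st1 : faithful_semitoric Phi1) (st2 : faithful_semitoric Phi2).

Lemma base_iso_ff z : Bff Phi1 z -> Bff Phi2 (psi z).
Proof.
move=> [p ff <-]; exists (Psi p); last exact: iso_commutes iso p.
apply: (focus_focus_natural iso) ff; [exact: semitoric_smooth|exact: semitoric_smooth|].
by case: st2.
Qed.

Lemma base_iso_continuous : {within Bimg Phi1, continuous psi}.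
Proof. exact/smooth_on_continuous/(iso_base_smooth iso). Qed.

End BaseMap.

Section BaseMapWt.
Context {R : realType} {M1 M2 : symplectic4 R} {Phi1 : M1 -> 'rV[R]_2} {Phi2 : M2 -> 'rV[R]_2}
  {Psi : M1 -> M2} {Psi' : M2 -> M1} {psi psi' : 'rV[R]_2 -> 'rV[R]_2}
  (iso : fibered_iso Phi1 Phi2 Psi Psi' psi psi')
  (st1 : faithful_semitoric Phi1) (st2 : faithful_semitoric Phi2).
Let iso' := fibered_iso_sym iso.

Lemma base_iso_ffE z : Bimg Phi1 z -> Bff Phi2 (psi z) -> Bff Phi1 z.
Proof. by move=> Bz /(base_iso_ff iso' st2 st1); rewrite (base_isoK iso Bz). Qed.

Lemma base_iso_wt z : Bwt Phi1 z -> Bwt Phi2 (psi z).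
Proof.
by move=> [Bz nz]; split; [exact: base_iso_img iso _ Bz | move=> /(base_iso_ffE Bz)].
Qed.

End BaseMapWt.

Section AffineCharts.
Context {R : realType} {M1 M2 : symplectic4 R} {Phi1 : M1 -> 'rV[R]_2} {Phi2 : M2 -> 'rV[R]_2}
  {Psi : M1 -> M2} {Psi' : M2 -> M1} {psi psi' : 'rV[R]_2 -> 'rV[R]_2}
  (iso : fibered_iso Phi1 Phi2 Psi Psi' psi psi')
  (st1 : faithful_semitoric Phi1) (st2 : faithful_semitoric Phi2).
Let iso' := fibered_iso_sym iso.

(** Charts move forward while cartographic maps are pulled back: [Z_affine] for the first system is
    tested on its charts, and these must become charts of the second system before the hypothesis on
    [f] can be used. *)
Lemma affine_chart_transport U chi : affine_chart Phi1 U chi ->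
  affine_chart Phi2 (psi @` U) (chi \o psi').
Proof.
move=> [[Q [oQ UE]] cU [schi [kap [skap kapK]]] [rho [ta eff mm]]].
have UB z : U z -> Bimg Phi1 z by rewrite UE => -[_ []].
have oW : open (Phi1 @^-1` U) by rewrite UE; exact: (open_preimage_Bwt st1).
(* With this identity the transported torus action lives exactly over the new chart domain. *)
have WE : Phi2 @^-1` (psi @` U) = Psi' @^-1` (Phi1 @^-1` U).
  apply/seteqP; split=> q /=; rewrite (iso_commutes_inv iso).
    by move=> [z Uz <-]; rewrite (base_isoK iso (UB _ Uz)).
  by exists (psi' (Phi2 q)) => //; rewrite (base_isoVK iso) //; exists q.
split.
- have [Q' [oQ' Q'E]] := within_preimage_open (base_iso_continuous iso') oQ.
  exists Q'; split=> //; rewrite UE; apply/seteqP; split=> z.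
    move=> [y [Qy wy] <-]; have [By _] := wy.
    split; last exact: base_iso_wt iso st1 st2 _ wy.
    have : (Bimg Phi2 `&` psi' @^-1` Q) (psi y).
      by split; [exact: base_iso_img iso _ By | rewrite /= (base_isoK iso By)].
    by rewrite Q'E => -[].
  move=> [Q'z wz]; have [Bz _] := wz.
  have : (Q' `&` Bimg Phi2) z by [].
  rewrite -Q'E => -[_ Qz]; exists (psi' z); last exact: base_isoVK iso _ Bz.
  by split=> //; exact: base_iso_wt iso' st2 st1 _ wz.
- apply: connected_continuous_connected => //.
  exact: continuous_subspaceW (base_iso_continuous iso).
- have K z : (psi @` U) z -> U (psi' z).
    by move=> [y Uy <-]; rewrite (base_isoK iso (UB _ Uy)).
  have sub : psi @` U `<=` Bimg Phi2.
    by move=> _ [y Uy <-]; apply: (base_iso_img iso); exact: UB.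
  split.
    apply: (smooth_on_comp K) => //.
    exact: smooth_on_sub sub (iso_base_smooth_inv iso).
  exists (psi \o kap); split=> [|z Uz].
    have im w : ((chi \o psi') @` (psi @` U)) w -> (chi @` U) w.
      by move=> [z /K Uz <-]; exists (psi' z).
    apply: (smooth_on_comp (B := U)).
    + by move=> w /im[z Uz <-]; rewrite kapK.
    + exact: smooth_on_sub im skap.
    + exact: smooth_on_sub UB (iso_base_smooth iso).
  by rewrite /= kapK ?(base_isoVK iso) //; [exact: sub | exact: K].
exists (transported_action (Psi := Psi) (Psi' := Psi') rho); rewrite WE; split.
- exact: torus_action_transport iso _ _ _ _ ta.
- exact: effective_transport iso _ _ _ eff.
- have -> : (chi \o psi') \o Phi2 = (chi \o Phi1) \o Psi'.
    by apply/funext => q; rewrite /= (iso_commutes_inv iso).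
  exact: moment_map_transport iso _ _ _ _ _ ta mm.
Qed.

End AffineCharts.

(** * Derivatives on subsets of the base *)

Section SubsetDerivative.
Context {R : realType} {M : symplectic4 R} {Phi : M -> 'rV[R]_2}
  (st : faithful_semitoric Phi).

Implicit Types (A U : set 'rV[R]_2) (w : 'rV[R]_2) (f g : 'rV[R]_2 -> 'rV[R]_2).

Definition relatively_open (A : set 'rV[R]_2) : Prop :=
  exists Q, open Q /\ A = Q `&` Bimg Phi.

Lemma relatively_open_Bimg : relatively_open (Bimg Phi).
Proof. by exists setT; rewrite setTI; split=> //; exact: openT. Qed.

Lemma jacobian_extension_regular p (Q : set 'rV[R]_2) (g g' : 'rV[R]_2 -> 'rV[R]_2) :
  open Q -> smooth_open Q g -> smooth_open Q g' ->
  (forall z, Q z -> Bimg Phi z -> g z = g' z) -> Q (Phi p) -> rk Phi p = 2%N ->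
  jacobian g (Phi p) = jacobian g' (Phi p).
Proof.
move=> oQ sg sg' gg Qp rk2; have sPhi := semitoric_smooth st.
set i := chart_at p; set x := chart i p; have dp : dom i p := dom_chart_at p.
have dPhi : differentiable (Phi \o param i) x.
  by apply: (smooth_open_differentiable (smooth_to_rep i sPhi)); exists p.
have E : (Phi \o param i) x = Phi p by rewrite /x /= chartK.
have dg : differentiable g ((Phi \o param i) x).
  by rewrite E; exact: smooth_open_differentiable sg Qp.
have dg' : differentiable g' ((Phi \o param i) x).
  by rewrite E; exact: smooth_open_differentiable sg' Qp.
have full : row_full (jacobian (Phi \o param i) x) by apply/eqP.
rewrite -E; apply: (row_full_inj full).
apply: etrans (esym (jacobian_comp dPhi dg)) _.
apply: etrans _ (jacobian_comp dPhi dg').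
have cPhi := smooth_to_continuous sPhi.
pose D := chart i @` (dom i `&` Phi @^-1` Q).
apply: (@open_eq_jacobian _ _ _ D).
- by apply: open_chart_image; move/continuousP: cPhi; apply.
- by exists p.
- by move=> _ [q [dq Qq] <-]; rewrite /= chartK // gg //; exists q.
- exact: differentiable_comp.
Qed.

Lemma jacobian_extension_unique A f w U g U' (g' : 'rV[R]_2 -> 'rV[R]_2) : relatively_open A -> A w ->
  extends_near A f w U g -> extends_near A f w U' g' -> jacobian g w = jacobian g' w.
Proof.
move=> [Q [oQ AE]] Aw [oU Uw sg eg] [oU' U'w sg' eg'].
have sPhi := semitoric_smooth st; have cPhi := smooth_to_continuous sPhi.
pose V := Q `&` (U `&` U').
have oV : open V by apply: openI => //; exact: openI.
have sgV : smooth_open V g by apply: smooth_sub sg => z [_ []].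
have sgV' : smooth_open V g' by apply: smooth_sub sg' => z [_ []].
have [p _ pw] : Bimg Phi w by move: Aw; rewrite AE => -[].
have Vw : V w by split=> //; move: Aw; rewrite AE => -[].
have gg z : V z -> Bimg Phi z -> g z = g' z.
  move=> [Qz [Uz U'z]] Bz; have Az : A z by rewrite AE.
  by rewrite eg ?eg'.
apply/matrixP => k l; apply: contrapT => /eqP ne.
(* If an entry of the two Jacobians differed at [w], it would differ nearby. The preimage of that
   neighborhood under [Phi] is open and nonempty, so it contains a regular point; density is thus
   used in the manifold, not in the base. *)
pose d z := jacobian g z k l - jacobian g' z k l.
have cd z : V z -> {for z, continuous d}.
  move=> Vz; apply: continuousB.
    exact: smooth_open_continuous (smooth_jacobian k l oV sgV) Vz.
  exact: smooth_open_continuous (smooth_jacobian k l oV sgV') Vz.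
have oN : open (Phi @^-1` (V `&` d @^-1` [set t | t != 0])).
  move/continuousP: cPhi; apply; apply: open_setI_preimage => //.
case: st => -[_ _ [D [oD dD Dreg]] _] _ _ _ _.
have N0 : Phi @^-1` (V `&` d @^-1` [set t | t != 0]) !=set0.
  by exists p; rewrite /= pw; split=> //=; rewrite subr_eq0.
have [q [[Vq dq] Dq]] := dD _ N0 oN.
move/eqP: dq; apply; rewrite /d.
by rewrite (jacobian_extension_regular oV sgV sgV' gg Vq (Dreg q Dq)) subrr.
Qed.

Lemma DsubE A f w U g : relatively_open A -> A w -> extends_near A f w U g ->
  Dsub A f w = (jacobian g w)^T.
Proof.
move=> rA Aw eg; rewrite /Dsub; case: xgetP => [L _ [U' [g' [eg' ->]]]|].
  by rewrite (jacobian_extension_unique rA Aw eg' eg).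
by move=> /(_ (jacobian g w)^T); case; exists U, g.
Qed.

Lemma Dsub_continuous A f w : relatively_open A -> A w -> smooth_on A f ->
  Dsub A f z @[z --> within A (nbhs w)] --> Dsub A f w.
Proof.
move=> rA Aw sf; have [U [g eg]] := sf w Aw.
rewrite (DsubE rA Aw eg); have [oU Uw sg _] := eg.
have cJ : (jacobian g z)^T @[z --> nbhs w] --> (jacobian g w)^T.
  apply: cvg_trmx; apply: (smooth_open_continuous _ Uw).
  exact: smooth_jacobian_mx.
move=> N /cJ nN.
apply: filterS2 (open_nbhs_nbhs (conj oU Uw)) nN => z Uz Nz Az.
by change (N (Dsub A f z)); rewrite (DsubE rA Az (extends_near_shift eg Uz)).
Qed.

Lemma Dsub_fst A f w : relatively_open A -> A w -> smooth_on A f ->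
  (forall z, A z -> f z 0 0 = z 0 0) -> Dsub A f w 0 1 = 0.
Proof.
move=> rA Aw sf f0; have [U [g [oU Uw sg eg]]] := sf w Aw.
(* An extension need not preserve the first coordinate off [A]. The correction vanishes on [A], so
   [g'] is another extension and computes the same derivative. *)
pose g' (z : 'rV[R]_2) : 'rV[R]_2 := g z + (z 0 0 - g z 0 0) *: delta_mx 0 0.
have sg' : smooth_open U g'.
  have s1 : smooth_open U (fun z : 'rV[R]_2 => z 0 0).
    by apply: (smooth_lin (c := coordl 0 0)) => //; exact: coord_continuous.
  have s2 := smooth_coord 0 0 oU sg.
  have s3 : smooth_open U (fun z => z 0 0 - g z 0 0).
    have s4 := smooth_scale oU (@smooth_cst _ _ R U (-1)) s2.
    move=> k; apply: Ck_eq (CkD oU (s1 k) (s4 k)) => // z _.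
    by rewrite /= scaleN1r.
  move=> k; exact: (CkD oU (sg k) (smooth_scale oU s3 (smooth_cst U _) k)).
have eg' : extends_near A f w U g'.
  split=> // z [Uz Az]; rewrite /g' eg // f0 // subrr scale0r addr0 //.
rewrite (DsubE rA Aw eg') mxE.
have dg' := smooth_open_differentiable sg' Uw.
rewrite jacobianE // (derive_coord _ _ _ dg').
have -> : (fun z => g' z 0 0) = (fun z : 'rV[R]_2 => id z 0 0).
  by apply/funext => z; rewrite /g' !mxE eqxx mulr1 addrC subrK.
by rewrite -(derive_coord (A := id)) // derive_id mxE.
Qed.

End SubsetDerivative.

(** * The derivative of the base map and its sign *)

Section BaseDerivative.
Context {R : realType} {M1 M2 : symplectic4 R} {Phi1 : M1 -> 'rV[R]_2} {Phi2 : M2 -> 'rV[R]_2}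
  {Psi : M1 -> M2} {Psi' : M2 -> M1} {psi psi' : 'rV[R]_2 -> 'rV[R]_2}
  (iso : fibered_iso Phi1 Phi2 Psi Psi' psi psi')
  (st1 : faithful_semitoric Phi1) (st2 : faithful_semitoric Phi2).
Local Notation B1 := (Bimg Phi1).
Local Notation B2 := (Bimg Phi2).
Implicit Types (z w : 'rV[R]_2).

Lemma relatively_open_sub (M : symplectic4 R) (Phi : M -> 'rV[R]_2) A :
  relatively_open (Phi := Phi) A -> A `<=` Bimg Phi.
Proof. by move=> [Q [_ ->]] z []. Qed.

Lemma Dsub_comp A1 A2 (f : 'rV[R]_2 -> 'rV[R]_2) w :
  relatively_open (Phi := Phi1) A1 -> relatively_open (Phi := Phi2) A2 ->
  (forall z, A1 z -> A2 (psi z)) -> smooth_on A2 f -> A1 w ->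
  Dsub A1 (f \o psi) w = Dsub A2 f (psi w) *m Dsub B1 psi w.
Proof.
move=> r1 r2 AA sf Aw; have Bw : B1 w := relatively_open_sub r1 Aw.
have [U [g eg]] := iso_base_smooth iso Bw.
have eg1 : extends_near A1 psi w U g.
  case: eg => oU Uw sg eg; split=> // z [Uz Az]; apply: eg; split=> //.
  exact: relatively_open_sub r1 _ Az.
have [U' [h eh]] := sf _ (AA w Aw).
rewrite (DsubE st1 r1 Aw (extends_near_comp AA Aw eg1 eh)).
rewrite (DsubE st2 r2 (AA w Aw) eh) (DsubE st1 relatively_open_Bimg Bw eg).
have [_ Uw sg _] := eg; have [_ U'w sh _] := eh.
have E : g w = psi w by case: eg => _ _ _; apply.
have dg := smooth_open_differentiable sg Uw.
have dh : differentiable h (g w) by rewrite E; exact: smooth_open_differentiable sh U'w.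
by rewrite (jacobian_comp dg dh) trmx_mul E.
Qed.

Lemma Dsub_base_inv z : B1 z -> Dsub B2 psi' (psi z) *m Dsub B1 psi z = 1%:M.
Proof.
move=> Bz.
rewrite -(Dsub_comp (A1 := B1) (A2 := B2) relatively_open_Bimg relatively_open_Bimg) //;
  [|exact: base_iso_img iso|exact: iso_base_smooth_inv iso].
have e : extends_near B1 (psi' \o psi) z setT id.
  split=> //; first exact: openT.
    by apply: (smooth_lin (c := idfun)) => //; [exact: openT | move=> x; exact: cvg_id].
  by move=> w [_ Bw]; rewrite /= (base_isoK iso Bw).
by rewrite (DsubE st1 relatively_open_Bimg Bz e) jacobian_id trmx1.
Qed.

Lemma Dsub_base01 z : B1 z -> Dsub B1 psi z 0 1 = 0.
Proof.
move=> Bz; apply: (Dsub_fst st1 relatively_open_Bimg Bz).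
  exact: iso_base_smooth iso.
exact: iso_fst iso.
Qed.

Lemma mulmx2E (A B : 'M[R]_2) i j : (A *m B) i j = A i 0 * B 0 j + A i 1 * B 1 j.
Proof.
rewrite mxE !big_ord_recl big_ord0 addr0.
by have -> : lift ord0 ord0 = 1 :> 'I_2 by exact/val_inj.
Qed.

Lemma triangular_diag_neq0 (X Y : 'M[R]_2) : X *m Y = 1%:M -> Y 0 1 = 0 -> Y 1 1 != 0.
Proof.
move=> /(congr1 (fun A : 'M[R]_2 => A 1 1)) E Y0; move: E.
rewrite mulmx2E Y0 mulr0 add0r mxE eqxx => E.
by apply/eqP => H; move: E; rewrite H mulr0 => /eqP; rewrite eq_sym oner_eq0.
Qed.

(** The derivative of [psi] is invertible, and it is lower triangular because [psi] preserves the
    first coordinate. *)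
Lemma Dsub_base11_neq0 z : B1 z -> Dsub B1 psi z 1 1 != 0.
Proof. by move=> Bz; exact: triangular_diag_neq0 (Dsub_base_inv Bz) (Dsub_base01 Bz). Qed.

Lemma Bimg_connected : connected B1.
Proof.
case: st1 => _ cM _ _ _; apply: connected_continuous_connected => //.
exact/continuous_subspaceT/smooth_to_continuous/(semitoric_smooth st1).
Qed.

Lemma base_sign : exists2 s : R, s = 1 \/ s = -1 &
  forall z, B1 z -> Num.sg (Dsub B1 psi z 1 1) = s.
Proof.
pose d z := Dsub B1 psi z 1 1.
have cd : {within B1, continuous d}.
  apply/subspace_continuousP => z Bz.
  apply: (@cvg_mx_coord _ _ _ _ _ (Dsub B1 psi) (Dsub B1 psi z) 1 1).
  exact: (Dsub_continuous st1 relatively_open_Bimg Bz (iso_base_smooth iso)).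
have ivl : is_interval (d @` B1).
  apply/connected_intervalP/connected_continuous_connected => //.
  exact: Bimg_connected.
have n0 : ~ (d @` B1) 0.
  by move=> [z Bz] /eqP; rewrite (negbTE (Dsub_base11_neq0 Bz)).
have opp z w : B1 z -> B1 w -> d z < 0 -> 0 < d w -> False.
  move=> Bz Bw dz dw; apply: n0; apply: (ivl (d z) (d w)).
  - by exists z.
  - by exists w.
  - by rewrite (ltW dz) (ltW dw).
have [[z [Bz dz]]|npos] := pselect (exists z, B1 z /\ 0 < d z).
  exists 1; first by left.
  move=> w Bw; have [dw|dw|dw] := ltgtP (d w) 0.
  - by exfalso; exact: opp Bw Bz dw dz.
  - exact: gtr0_sg.
  - by have := Dsub_base11_neq0 Bw; rewrite -/(d w) dw eqxx.
exists (-1); first by right.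
move=> w Bw; have [dw|dw|dw] := ltgtP (d w) 0.
- exact: ltr0_sg.
- by exfalso; apply: npos; exists w.
- by have := Dsub_base11_neq0 Bw; rewrite -/(d w) dw eqxx.
Qed.

Definition pt2 (x y : R) : 'rV[R]_2 := x *: delta_mx 0 0 + y *: delta_mx 0 1.

Lemma pt2_eta z : z = pt2 (z 0 0) (z 0 1).
Proof. exact: row2_delta. Qed.

Lemma pt2_0 x y : pt2 x y 0 0 = x.
Proof. by rewrite !mxE /= mulr1 mulr0 addr0. Qed.

Lemma pt2_1 x y : pt2 x y 0 1 = y.
Proof. by rewrite !mxE /= mulr1 mulr0 add0r. Qed.

(** A fiber of J is connected by (F4), so its image under the second component of [Phi] is an
    interval. *)
Lemma vertical_segment x a b t : B1 (pt2 x a) -> B1 (pt2 x b) -> a <= t <= b ->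
  B1 (pt2 x t).
Proof.
case: st1 => _ _ _ _ [rho [_ F4 _ _]] [p _ pa] [q _ qb] atb.
have cPhi := smooth_to_continuous (semitoric_smooth st1).
pose h p := Phi1 p 0 1.
have ch : continuous h.
  move=> r; apply: (@continuous_comp _ _ _ Phi1 (fun z : 'rV[R]_2 => z 0 1)).
    exact: cPhi.
  exact: coord_continuous.
have ivl : is_interval (h @` (fstJ Phi1 @^-1` [set x])).
  apply/connected_intervalP/connected_continuous_connected; first exact: F4.
  exact: continuous_subspaceT.
have [||r rx rt] := ivl a b _ _ t atb.
- by exists p; rewrite /h /= /fstJ pa ?pt2_0 ?pt2_1.
- by exists q; rewrite /h /= /fstJ qb ?pt2_0 ?pt2_1.
exists r => //; rewrite [LHS]pt2_eta; congr pt2; [exact: rx | exact: rt].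
Qed.

Lemma is_derive_pt2 x (t : R) : is_derive (t : R^o) (1 : R^o)
  (fun s : R^o => pt2 x s) (delta_mx 0 1).
Proof.
have -> : (fun s : R^o => pt2 x s) =
    cst (x *: delta_mx 0 0 : 'rV[R]_2) + (fun s : R^o => s *: (delta_mx 0 1 : 'rV[R]_2)).
  by [].
have d := is_diffD (is_diff_cst (x *: delta_mx 0 0 : 'rV[R]_2) (t : R^o))
   (is_diff_scalel t (delta_mx 0 1 : 'rV[R]_2)).
have [dd dv] := d.
apply: DeriveDef; first exact/derivable1_diffP.
by rewrite (deriveE _ dd) dv !fctE add0r scale1r.
Qed.

End BaseDerivative.

(** * Orientation of the vertical slices *)

Section Orientation.
Context {R : realType} {M1 M2 : symplectic4 R} {Phi1 : M1 -> 'rV[R]_2} {Phi2 : M2 -> 'rV[R]_2}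
  {Psi : M1 -> M2} {Psi' : M2 -> M1} {psi psi' : 'rV[R]_2 -> 'rV[R]_2}
  (iso : fibered_iso Phi1 Phi2 Psi Psi' psi psi')
  (st1 : faithful_semitoric Phi1) (st2 : faithful_semitoric Phi2).
Local Notation B1 := (Bimg Phi1).
Implicit Types (z w : 'rV[R]_2).

(** At an interior point of the segment all nearby points of the vertical line lie in the base,
    where [psi] agrees with its extension. At the endpoints this may fail; there the mean value
    theorem asks only for continuity. *)
Lemma base_vertical_derive x a b t : B1 (pt2 x a) -> B1 (pt2 x b) -> t \in `]a, b[ ->
  is_derive (t : R) (1 : R) (fun y => psi (pt2 x y) 0 1) (Dsub B1 psi (pt2 x t) 1 1).
Proof.
move=> Ba Bb tab.
have seg y : y \in `]a, b[ -> B1 (pt2 x y).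
  rewrite in_itv /= => /andP[ay yb]; apply: (vertical_segment st1 Ba Bb).
  by rewrite !ltW.
have Bt := seg t tab.
have [U [g eg]] := iso_base_smooth iso Bt.
rewrite (DsubE st1 relatively_open_Bimg Bt eg) mxE.
have [oU Ut sg eg'] := eg.
have dg := smooth_open_differentiable sg Ut.
have := is_derive_coord 1 (is_derive_local_rep (is_derive_pt2 x t) dg).
rewrite -rowE [row _ _ _ _]mxE; apply: near_eq_is_derive.
have nU : \forall s \near t, U (pt2 x s).
  have [/derivable1_diffP/differentiable_continuous ct _] := is_derive_pt2 x t.
  by apply: ct; exact: open_nbhs_nbhs.
have nI : \forall s \near t, s \in `]a, b[ by exact: near_in_itvoo.
apply: filterS2 nU nI => s Us sI; rewrite /= eg' //; split=> //; exact: seg.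
Qed.

Lemma base_vertical_continuous x a b : B1 (pt2 x a) -> B1 (pt2 x b) ->
  {within `[a, b], continuous (fun y => psi (pt2 x y) 0 1)}.
Proof.
move=> Ba Bb.
have seg y : y \in `[a, b] -> B1 (pt2 x y).
  by rewrite in_itv /=; exact: (vertical_segment st1 Ba Bb).
apply/subspace_continuousP => t tab.
have [U [g [oU Ut sg eg]]] := iso_base_smooth iso (seg t tab).
have cp : {for t, continuous (pt2 x)}.
  by have [/derivable1_diffP/differentiable_continuous ct _] := is_derive_pt2 x t.
have cg : {for t, continuous (fun y => g (pt2 x y) 0 1)}.
  apply: (@continuous_comp _ _ _ (fun y => g (pt2 x y)) (fun z : 'rV[R]_2 => z 0 1)).
    by apply: continuous_comp => //; exact: smooth_open_continuous sg Ut.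
  exact: coord_continuous.
have nU : \forall s \near t, U (pt2 x s) by apply: cp; exact: open_nbhs_nbhs.
move=> N Nf; have gN : nbhs t [set y | N (g (pt2 x y) 0 1)].
  by apply: cg; rewrite /= eg //; split=> //; exact: seg.
apply: filterS2 nU gN => s Us Ns sab; change (N (psi (pt2 x s) 0 1)).
by rewrite -eg //; split=> //; exact: seg.
Qed.

(** The mean value theorem along a vertical segment of the base. Stating it with signs covers both
    orders and equality at once. *)
Lemma base_monotone s : (forall z, B1 z -> Num.sg (Dsub B1 psi z 1 1) = s) ->
  forall z w, B1 z -> B1 w -> z 0 0 = w 0 0 ->
  Num.sg (psi w 0 1 - psi z 0 1) = s * Num.sg (w 0 1 - z 0 1).
Proof.
move=> sE.
have main x a b : a < b -> B1 (pt2 x a) -> B1 (pt2 x b) ->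
    Num.sg (psi (pt2 x b) 0 1 - psi (pt2 x a) 0 1) = s.
  move=> ab Ba Bb.
  have H1 (t : R) : t \in `]a, b[ ->
      is_derive t 1 (fun y => psi (pt2 x y) 0 1) (Dsub B1 psi (pt2 x t) 1 1).
    exact: base_vertical_derive.
  have H2 := base_vertical_continuous Ba Bb.
  have [c cab ->] := MVT ab H1 H2.
  rewrite sgrM [Num.sg (b - a)]gtr0_sg ?subr_gt0 // mulr1 sE //.
  apply: (vertical_segment st1 Ba Bb).
  by move: cab; rewrite in_itv /= => /andP[? ?]; rewrite !ltW.
move=> z w Bz Bw zw; rewrite (pt2_eta z) (pt2_eta w) -zw in Bz Bw *.
rewrite !pt2_1; have [lt|gt|->] := ltgtP (z 0 1) (w 0 1).
- by rewrite main // gtr0_sg ?subr_gt0 // mulr1.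
- rewrite -opprB sgrN main // -opprB sgrN gtr0_sg ?subr_gt0 //.
  by rewrite mulrN mulr1.
- by rewrite !subrr sgr0 mulr0.
Qed.

End Orientation.

(** * Pullback of cartographic pairs *)

Lemma within_continuous_comp (T S X : topologicalType) (A : set T) (B : set S)
    (f : T -> S) (g : S -> X) : (forall x, A x -> B (f x)) ->
  {within A, continuous f} -> {within B, continuous g} -> {within A, continuous (g \o f)}.
Proof.
move=> AB /subspace_continuousP cf /subspace_continuousP cg.
apply/subspace_continuousP => x Ax N nN.
have nB : nbhs (f x) [set y | B y -> N (g y)] := cg (f x) (AB x Ax) N nN.
have nA : nbhs x [set y | A y -> B (f y) -> N (g (f y))] := cf x Ax _ nB.
apply: filterS nA => y h Ay.
by apply: h => //; exact: AB.
Qed.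

Lemma triangular_mul11 (R : realType) (X Y : 'M[R]_2) : Y 0 1 = 0 ->
  (X *m Y) 1 1 = X 1 1 * Y 1 1.
Proof. by move=> Y0; rewrite mulmx2E Y0 mulr0 add0r. Qed.

Lemma pullback_closure (R : realType) (M1 M2 : symplectic4 R) (Phi1 : M1 -> 'rV[R]_2)
    (Phi2 : M2 -> 'rV[R]_2) Psi Psi' psi psi' (A1 A2 : set 'rV[R]_2) z :
  fibered_iso Phi1 Phi2 Psi Psi' psi psi' ->
  Bimg Phi1 z -> A2 `<=` Bimg Phi2 -> (forall w, A2 w -> A1 (psi' w)) ->
  closure A2 (psi z) -> closure A1 z.
Proof.
move=> iso Bz sub AA cl N nN.
have /subspace_continuousP c := base_iso_continuous (fibered_iso_sym iso).
have nN' : nbhs (psi' (psi z)) N by rewrite (base_isoK iso Bz).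
have [w [Aw Nw]] := cl _ (c (psi z) (base_iso_img iso Bz) N nN').
by exists (psi' w); split; [exact: AA | apply: Nw; exact: sub].
Qed.

Section PullbackCartographic.
Context {R : realType} {M1 M2 : symplectic4 R} {Phi1 : M1 -> 'rV[R]_2} {Phi2 : M2 -> 'rV[R]_2}
  {Psi : M1 -> M2} {Psi' : M2 -> M1} {psi psi' : 'rV[R]_2 -> 'rV[R]_2}
  (iso : fibered_iso Phi1 Phi2 Psi Psi' psi psi')
  (st1 : faithful_semitoric Phi1) (st2 : faithful_semitoric Phi2).
Let iso' := fibered_iso_sym iso.
Local Notation B1 := (Bimg Phi1).
Local Notation B2 := (Bimg Phi2).
Implicit Types (z w c : 'rV[R]_2).

Context {s : R} {eps : 'rV[R]_2 -> R} {f : 'rV[R]_2 -> 'rV[R]_2}.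
Hypothesis s_sign : s = 1 \/ s = -1.
Hypothesis sE : forall z, B1 z -> Num.sg (Dsub B1 psi z 1 1) = s.
Hypothesis eps_sign : sign_choice Phi2 eps.

Definition pullback_sign c := s * eps (psi c).
Local Notation eps1 := pullback_sign.

Lemma Bff_sub (M : symplectic4 R) (Phi : M -> 'rV[R]_2) : Bff Phi `<=` Bimg Phi.
Proof. by move=> _ [p _ <-]; exists p. Qed.

(** The inequality defining a cut depends on the vertical difference only through its sign, which
    [psi] multiplies by [s]. *)
Lemma sign_le (e X Y : R) : e = 1 \/ e = -1 -> Num.sg Y = s * Num.sg X ->
  (0 <= s * e * X) = (0 <= e * Y).
Proof.
move=> he E.
have -> : (0 <= s * e * X) = (0 <= s * e * Num.sg X).
  by rewrite -![0 <= _ * _]sgr_ge0 !sgrM sgr_id.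
have -> : (0 <= e * Y) = (0 <= e * Num.sg Y).
  by rewrite -![0 <= _ * _]sgr_ge0 !sgrM sgr_id.
by rewrite E mulrA [e * s]mulrC.
Qed.

Lemma pullback_cut c z : Bff Phi1 c -> B1 z ->
  Defs.cut Phi1 eps1 c z <-> Defs.cut Phi2 eps (psi c) (psi z).
Proof.
move=> fc Bz; have Bc := Bff_sub fc.
have ec := eps_sign (base_iso_ff iso st1 st2 fc).
have fst_eq : (psi z 0 0 = psi c 0 0) = (z 0 0 = c 0 0).
  by rewrite !(iso_fst iso).
have ord : z 0 0 = c 0 0 ->
    (eps1 c * c 0 1 <= eps1 c * z 0 1) = (eps (psi c) * psi c 0 1 <= eps (psi c) * psi z 0 1).
  move=> zc; rewrite -subr_ge0 -mulrBr -[RHS]subr_ge0 -mulrBr.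
  exact: sign_le ec (base_monotone iso st1 sE Bc Bz (esym zc)).
rewrite /Defs.cut /=; split=> -[[e le] _]; split=> //.
- by split; [rewrite fst_eq | rewrite -ord].
- exact: base_iso_img iso _ Bz.
- by move: e; rewrite fst_eq => e; split=> //; rewrite ord.
Qed.

Lemma pullback_S z : B1 z -> S_eps Phi1 eps1 z <-> S_eps Phi2 eps (psi z).
Proof.
move=> Bz; split=> -[_ h]; split=> //.
- exact: base_iso_img iso _ Bz.
- move=> [c fc cz]; apply: h; have Bc := Bff_sub fc.
  exists (psi' c); first exact: base_iso_ff iso' st2 st1 _ fc.
  apply/pullback_cut => //; first exact: base_iso_ff iso' st2 st1 _ fc.
  by rewrite (base_isoVK iso Bc).
- move=> [c fc cz]; apply: h; exists (psi c); first exact: base_iso_ff iso st1 st2 _ fc.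
  exact/pullback_cut.
Qed.

(** [psi] is a bijection from the focus-focus values whose cuts contain [z] to those whose cuts
    contain [psi z], and corresponding summands differ by the factor [s]. *)
Lemma pullback_j z : B1 z -> j_eps Phi1 eps1 z = s * j_eps Phi2 eps (psi z).
Proof.
move=> Bz; rewrite /j_eps mulr_fsumr; symmetry; apply: reindex_fsbig; split.
- move=> c /= [fc cz]; split; first exact: base_iso_ff iso st1 st2 _ fc.
  exact/pullback_cut.
- move=> c c' /[!inE] -[fc _] [fc' _] E.
  by rewrite -(base_isoK iso (Bff_sub fc)) E (base_isoK iso (Bff_sub fc')).
- move=> c /= [fc cz]; have Bc := Bff_sub fc.
  have fc' : Bff Phi1 (psi' c) by exact: base_iso_ff iso' st2 st1 _ fc.
  exists (psi' c); last exact: base_isoVK iso _ Bc.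
  by split=> //; apply/pullback_cut => //; rewrite (base_isoVK iso Bc).
Qed.

Lemma pullback_sign_choice : sign_choice Phi1 eps1.
Proof.
move=> c fc; rewrite /pullback_sign.
have [->|->] := eps_sign (base_iso_ff iso st1 st2 fc);
  have [->|->] := s_sign; rewrite ?mulr1 ?mul1r ?mulN1r ?opprK; tauto.
Qed.

Lemma pullback_image : (f \o psi) @` B1 = f @` B2.
Proof.
apply/seteqP; split=> _ [z Bz <-]; first by exists (psi z) => //; exact: base_iso_img iso _ Bz.
exists (psi' z); first exact: base_iso_img_inv iso _ Bz.
by rewrite /= (base_isoVK iso Bz).
Qed.

Lemma pullback_topological_embedding :
  topological_embedding B2 f -> topological_embedding B1 (f \o psi).
Proof.
move=> [cf [g [cg gK]]]; split.
  exact: within_continuous_comp (base_iso_img iso) (base_iso_continuous iso) cf.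
exists (psi' \o g); rewrite pullback_image; split.
  apply: within_continuous_comp cg (base_iso_continuous iso').
  by move=> _ [z Bz <-]; rewrite gK.
by move=> z Bz; rewrite /= gK ?(base_isoK iso) //; exact: base_iso_img iso _ Bz.
Qed.

Lemma S_eps_sub (M : symplectic4 R) (Phi : M -> 'rV[R]_2) e : S_eps Phi e `<=` Bimg Phi.
Proof. by move=> z []. Qed.

Lemma pullback_relatively_open : relatively_open (Phi := Phi2) (S_eps Phi2 eps) ->
  relatively_open (Phi := Phi1) (S_eps Phi1 eps1).
Proof.
move=> [Q [oQ SE]].
have [Q' [oQ' Q'E]] := within_preimage_open (base_iso_continuous iso) oQ.
exists Q'; split=> //; rewrite -Q'E; apply/seteqP; split=> z.
  move=> Sz; have Bz := S_eps_sub Sz; split=> //.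
  by have /pullback_S := Sz; rewrite SE => /(_ Bz) [].
move=> [Bz Qz]; apply/pullback_S => //; rewrite SE; split=> //.
exact: base_iso_img iso _ Bz.
Qed.

Lemma pullback_cartographic_pair : cartographic_pair Phi2 f (S_eps Phi2 eps) ->
  cartographic_pair Phi1 (f \o psi) (S_eps Phi1 eps1).
Proof.
move=> [te sub [ro cl] [sf [g [sg gK]]] za].
have SS z : S_eps Phi1 eps1 z -> S_eps Phi2 eps (psi z).
  by move=> Sz; apply/pullback_S => //; exact: S_eps_sub Sz.
have SS' w : S_eps Phi2 eps w -> S_eps Phi1 eps1 (psi' w).
  move=> Sw; have Bw := S_eps_sub Sw; apply/pullback_S.
    exact: base_iso_img_inv iso _ Bw.
  by rewrite (base_isoVK iso Bw).
split.
- exact: pullback_topological_embedding.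
- move=> z Sz; have Bz := S_eps_sub Sz; split=> // /(base_iso_ff iso st1 st2).
  by have [] := sub _ (SS _ Sz).
- split; first exact: pullback_relatively_open.
  move=> z Bz; apply: (pullback_closure iso Bz _ SS'); first exact: S_eps_sub.
  exact/cl/(base_iso_img iso).
- split.
    apply: (smooth_on_comp SS) => //.
    exact: smooth_on_sub (@S_eps_sub _ _ _) (iso_base_smooth iso).
  exists (psi' \o g); split.
    apply: (smooth_on_comp (B := S_eps Phi2 eps)).
    + by move=> _ [z /SS Sz <-]; rewrite gK.
    + apply: smooth_on_sub sg => _ [z /SS Sz <-]; by exists (psi z).
    + exact: smooth_on_sub (@S_eps_sub _ _ _) (iso_base_smooth_inv iso).
  by move=> z Sz; rewrite /= gK ?(base_isoK iso) //; [exact: S_eps_sub Sz | exact: SS].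
- move=> U chi chart z [Uz Sz].
  have UB w : U w -> B1 w by case: chart => -[Q [_ ->]] _ _ _ [_ []].
  (* In the transported chart [chi \o psi'], [f] has the same coordinate expression as [f \o psi] in
     [chi], so the same [A] and [b] serve. *)
  have chart2 := affine_chart_transport iso st1 st2 chart.
  have [|Q [A [b [oQ Qz uA h]]]] := za _ _ chart2 (psi z).
    by split; [exists z | exact: SS].
  exists Q, A, b; split=> //.
    by move: Qz; rewrite /= (base_isoK iso (UB _ Uz)).
  move=> w [Uw Sw] Qw; have := h (psi w).
  rewrite /= (base_isoK iso (UB _ Uw)); apply=> //.
  by split; [exists w | exact: SS].
Qed.

Lemma pullback_within_cvg A1 (A2 : set 'rV[R]_2) z : B1 z -> A1 `<=` B1 ->
  (forall w, A1 w -> A2 (psi w)) ->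
  psi w @[w --> within A1 (nbhs z)] --> within A2 (nbhs (psi z)).
Proof.
move=> Bz sub AA N nN.
have /subspace_continuousP c := base_iso_continuous iso.
have nB : nbhs z [set w | B1 w -> A2 (psi w) -> N (psi w)] := c z Bz _ nN.
apply: filterS nB => w h Aw.
by apply: h; [exact: sub | exact: AA].
Qed.

(** The derivative of [psi] converges to its value at [z] along the whole base, so any jump comes
    from [f] alone. [A1] and [A2] will be the parts on one side of the wall. *)
Lemma pullback_Dsub_cvg A1 (A2 : set 'rV[R]_2) z (L : 'M[R]_2) : relatively_open (Phi := Phi2) (S_eps Phi2 eps) ->
  smooth_on (S_eps Phi2 eps) f ->
  B1 z -> A1 `<=` S_eps Phi1 eps1 -> (forall w, A1 w -> A2 (psi w)) ->
  Dsub (S_eps Phi2 eps) f w @[w --> within A2 (nbhs (psi z))] --> L ->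
  Dsub (S_eps Phi1 eps1) (f \o psi) w @[w --> within A1 (nbhs z)] -->
    L *m Dsub B1 psi z.
Proof.
move=> ro sf Bz sub AA cL.
have SS w : S_eps Phi1 eps1 w -> S_eps Phi2 eps (psi w).
  by move=> Sz; apply/pullback_S => //; exact: S_eps_sub Sz.
have subB : A1 `<=` B1 by move=> w /sub/S_eps_sub.
have c1 : Dsub (S_eps Phi2 eps) f (psi w) @[w --> within A1 (nbhs z)] --> L.
  exact: cvg_trans (cvg_app _ (pullback_within_cvg Bz subB AA)) cL.
have c2 : Dsub B1 psi w @[w --> within A1 (nbhs z)] --> Dsub B1 psi z.
  move=> N nN.
  have nB : nbhs z [set w | B1 w -> N (Dsub B1 psi w)] :=
    Dsub_continuous st1 relatively_open_Bimg Bz (iso_base_smooth iso) nN.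
  by apply: filterS nB => w h Aw; apply: h; exact: subB.
have c3 := cvg_mulmx (within_filter A1 (nbhs_filter z)) c1 c2.
move=> N nN.
have nA : nbhs z [set w | A1 w ->
    N (Dsub (S_eps Phi2 eps) f (psi w) *m Dsub B1 psi w)] := c3 N nN.
apply: filterS nA => w h Aw.
change (N (Dsub (S_eps Phi1 eps1) (f \o psi) w)).
rewrite (Dsub_comp iso st1 st2 (pullback_relatively_open ro) ro SS sf (sub _ Aw)).
exact: h.
Qed.

Lemma pullback_semitoric_cartographic : semitoric_cartographic Phi2 eps f ->
  semitoric_cartographic Phi1 eps1 (f \o psi).
Proof.
move=> [_ cp f0 [s2 [sg2 wall]]].
have [_ _ [ro _] [sf _] _] := cp.
have SS w : S_eps Phi1 eps1 w -> S_eps Phi2 eps (psi w).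
  by move=> Sz; apply/pullback_S => //; exact: S_eps_sub Sz.
have ro1 := pullback_relatively_open ro.
split.
- exact: pullback_sign_choice.
- exact: pullback_cartographic_pair.
- by move=> z Bz; rewrite /= f0 ?(iso_fst iso) //; exact: base_iso_img iso _ Bz.
exists (s * s2); split.
  move=> z Sz; have Bz := S_eps_sub Sz.
  have E := congr1 (fun X : 'M[R]_2 => X 1 1) (Dsub_comp iso st1 st2 ro1 ro SS sf Sz).
  (* The derivative of [psi] is lower triangular, so the lower right entries multiply, and so do
     their signs. *)
  have E' := etrans E (triangular_mul11 _ (Dsub_base01 iso st1 Bz)).
  apply: etrans (congr1 Num.sg E') _; rewrite sgrM mulrC.
  have e2 := sg2 _ (SS z Sz); have e1 := sE Bz.
  apply: etrans (congr1 (fun a : R => a * _) e1) _.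
  exact: (congr1 (fun a : R => s * a) e2).
move=> z wz cll clr; have [Bz _] := wz.
(* The condition on [f] is available only where the base has points on both sides, so this property
   is carried from [z] to [psi z]. *)
have cl (A1 A2 : set 'rV[R]_2) : (forall w, B1 w -> A1 w -> A2 (psi w)) ->
    closure (B1 `&` A1) z -> closure (B2 `&` A2) (psi z).
  move=> AA; rewrite -{1}(base_isoK iso Bz).
  apply: (pullback_closure iso'); first exact: base_iso_img iso _ Bz.
    by move=> w [].
  by move=> w [Bw Aw]; split; [exact: base_iso_img iso _ Bw | exact: AA].
have LL w : B1 w -> left_of z w -> left_of (psi z) (psi w).
  by move=> Bw; rewrite /left_of /= !(iso_fst iso).
have RR w : B1 w -> right_of z w -> right_of (psi z) (psi w).
  by move=> Bw; rewrite /right_of /= !(iso_fst iso).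
have [Ll [Lr [cL cR E]]] := wall (psi z) (base_iso_wt iso st1 st2 wz)
  (cl _ _ LL cll) (cl _ _ RR clr).
exists (Ll *m Dsub B1 psi z), (Lr *m Dsub B1 psi z); split.
- apply: (pullback_Dsub_cvg ro sf Bz _ _ cL); first by move=> w [].
  by move=> w [Sw lw]; split; [exact: SS | exact: LL (S_eps_sub Sw) lw].
- apply: (pullback_Dsub_cvg ro sf Bz _ _ cR); first by move=> w [].
  by move=> w [Sw lw]; split; [exact: SS | exact: RR (S_eps_sub Sw) lw].
have -> : s * s2 * j_eps Phi1 eps1 z = s2 * j_eps Phi2 eps (psi z).
  rewrite (pullback_j Bz) mulrACA [s * s](_ : _ = 1) ?mul1r //.
  by have [->|->] := s_sign; rewrite ?mulr1 // mulrNN mulr1.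
by rewrite E -mulmxA.
Qed.

End PullbackCartographic.

Lemma semitoric_images_sub (R : realType) (M1 M2 : symplectic4 R)
    (Phi1 : M1 -> 'rV[R]_2) (Phi2 : M2 -> 'rV[R]_2) Psi Psi' psi psi' :
  fibered_iso Phi1 Phi2 Psi Psi' psi psi' ->
  faithful_semitoric Phi1 -> faithful_semitoric Phi2 ->
  semitoric_images Phi2 `<=` semitoric_images Phi1.
Proof.
move=> iso st1 st2 P [eps [f [sc ->]]].
have [s s_sign sE] := base_sign iso st1 st2.
have eps_sign : sign_choice Phi2 eps by case: sc.
exists (pullback_sign (psi := psi) (s := s) (eps := eps)), (f \o psi); split.
  exact: (pullback_semitoric_cartographic iso st1 st2 s_sign sE eps_sign sc).
by rewrite (pullback_image iso).
Qed.

Theorem lemma5p16 (R : realType) (M1 M2 : symplectic4 R)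
    (Phi1 : M1 -> 'rV[R]_2) (Phi2 : M2 -> 'rV[R]_2)
    (semitoric1 : faithful_semitoric Phi1)
    (semitoric2 : faithful_semitoric Phi2)
    (F7_1 : at_most_one_ff_per_fiber Phi1)
    (F7_2 : at_most_one_ff_per_fiber Phi2)
    (iso12 : strictly_isomorphic Phi1 Phi2)
    (has_ff : exists p : M1, focus_focus Phi1 p) :
  semitoric_images Phi1 = semitoric_images Phi2.
Proof.
have [Psi [Psi' [psi [psi' iso]]]] := strictly_isomorphic_fibered iso12.
apply/seteqP; split.
  exact: semitoric_images_sub (fibered_iso_sym iso) semitoric2 semitoric1.
exact: semitoric_images_sub iso semitoric1 semitoric2.
Qed.
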